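(* Suppose there exist a measurable function $w:S\to[1,\infty)$ and constants $\rho>0$, $b\ge 0$ such that: (i) there is an increasing sequence of measurable subsets $S_l\subseteq S$, $l=0,1,2,\dots$, with $\bigcup_{l=0}^\infty S_l=S$ and $\lim_{l\to\infty}\inf_{x\in S\setminus S_l}w(x)=\infty$; (ii) $\int_S q(dy|x,a)w(y)\le \rho w(x)+b$ for all $x\in S$, $a\in A(x)$; (iii) $\sup_{x\in S_l}\bar q_x<\infty$ for every $l\in\{0,1,2,\dots\}$. Then under any policy $\pi\in U$ the following assertions hold. (a) For any initial distribution $\gamma$, $P_\gamma^\pi(T_\infty=\infty)=1$, and hence $P_\gamma^\pi(\xi_t\in S)=1$ for all $t\ge 0$. Moreover, for all $x\in S$, $t\ge 0$, $$E_x^\pi[w(\xi_t)]\le e^{\rho t}w(x)+\frac{b}{\rho}(e^{\rho t}-1).$$ (b) Suppose additionally that $\int_S\gamma(dy)w(y)<\infty$, that $\alpha>\rho$, and that there exist constants $M\ge 0$, $c\ge 0$ such that $|\inf_{a\in A(x)}c_0(x,a)|\le Mw(x)+c$ for all $x\in S$. Then $$V_0(\pi)\ge -\frac{M\left(\alpha\int_S\gamma(dy)w(y)+b\right)}{\alpha(\alpha-\rho)}-\frac{c}{\alpha}>-\infty .$$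
   Context: Model. $S$ and $A$ are Borel spaces (state and action spaces) with Borel $\sigma$-algebras $\mathcal B(S),\mathcal B(A)$. For each $x\in S$, $A(x)\in\mathcal B(A)$ is the set of admissible actions; $K=\{(x,a)\in S\times A: a\in A(x)\}$ is a Borel subset of $S\times A$ containing the graph of a measurable function from $S$ to $A$. The transition rate $q(dy|x,a)$ is a signed kernel on $\mathcal B(S)$ given $(x,a)\in K$ with $q(\Gamma\setminus\{x\}|x,a)\ge 0$ for all $\Gamma\in\mathcal B(S)$, $q(S|x,a)=0$, and $\bar q_x:=\sup_{a\in A(x)}q_x(a)<\infty$ for each $x$, where $q_x(a):=-q(\{x\}|x,a)$. The cost rate $c_0:K\to\mathbb R$ is measurable, $\alpha>0$ is the discount factor, and $\gamma$ is a probability measure on $S$ (initial distribution). Controlled process. Adjoin isolated points $x_\infty\notin S$, $a_\infty\notin A$; put $S_\infty=S\cup\{x_\infty\}$, $A_\infty=A\cup\{a_\infty\}$, $A(x_\infty)=\{a_\infty\}$; $q$ and $c_0$ are extended by $0$ at $(x_\infty,a_\infty)$. $\Omega$ is the set of sequences $\omega=(x_0,\theta_1,x_1,\theta_2,\dots)$ that either have all $x_l\in S$, $\theta_l\in(0,\infty)$, or have the form $(x_0,\theta_1,x_1,\dots,\theta_{m-1},x_{m-1},\infty,x_\infty,\infty,x_\infty,\dots)$ for some $m\ge1$ with $x_l\in S$, $\theta_l\in(0,\infty)$ for the indices up to $m-1$; $\mathcal F$ is its natural $\sigma$-algebra. Put $T_0=0$, $T_m=\theta_1+\dots+\theta_m$,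 $T_\infty=\lim_m T_m$, $\xi_t=x_m$ if $T_m\le t<T_{m+1}$ and $\xi_t=x_\infty$ if $t\ge T_\infty$; $\mathcal F_t=\sigma(\{T_m\le s,x_m\in\Gamma\}:\Gamma\in\mathcal B(S),s\le t,m\ge0)$, $\mathcal F_{s-}=\bigvee_{t<s}\mathcal F_t$. The predictable $\sigma$-algebra $\mathcal P$ on $\Omega\times[0,\infty)$ is generated by the sets $\Gamma\times\{0\}$ ($\Gamma\in\mathcal F_0$) and $\Gamma\times(s,\infty)$ ($\Gamma\in\mathcal F_{s-}$). Policies. $U$ is the set of (randomized history-dependent) policies: $\mathcal P$-measurable transition probabilities $\pi(da|\omega,t)$ on $A_\infty$ concentrated on $A(\xi_{t-})$ (with $\xi_{0-}=x_0$). On $\{T_m<t\le T_{m+1}\}$ such a $\pi$ has the form $\pi(da|\omega,t)=\pi^m(da|x_0,\theta_1,\dots,x_m,t-T_m)$ with $\pi^m$ measurable and non-random. Put $\Lambda^m(\Gamma|h_m,u)=\int_A\pi^m(da|h_m,u)\,q(\Gamma\setminus\{x_m\}|x_m,a)$ for the history $h_m=(x_0,\theta_1,\dots,\theta_m,x_m)$. Measure. $P_\gamma^\pi$ is the unique probability measure on $(\Omega,\mathcal F)$ such that $x_0\sim\gamma$ and, for each $k\ge0$, given $h_k$: if $\theta_k<\infty$ (always regarded as true for $k=0$), then $(\theta_{k+1},x_{k+1})$ has law $\Lambda^k(dy|h_k,u)e^{-\int_0^u\Lambda^k(S|h_k,v)dv}du$ on $(0,\infty)\times S$ and mass $e^{-\int_0^\infty\Lambda^k(S|h_k,v)dv}$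 at $(\infty,x_\infty)$; if $\theta_k=\infty$, then $(\theta_{k+1},x_{k+1})=(\infty,x_\infty)$. $E_\gamma^\pi$ is the expectation; $P_x^\pi,E_x^\pi$ are used when $\gamma=\delta_x$. Performance functional: $V_0(\pi)=E_\gamma^\pi\left[\int_0^\infty e^{-\alpha t}\int_A c_0(\xi_{t-},a)\pi(da|\omega,t)\,dt\right]$. *)

(* Defs.v *)
From HB Require Import structures.
From mathcomp Require Import all_boot all_order all_algebra.
From mathcomp Require Import all_classical all_reals all_analysis.
From mathcomp Require Import measurable_realfun.

Set Implicit Arguments.
Unset Strict Implicit.
Unset Printing Implicit Defensive.
Import Order.TTheory GRing.Theory Num.Theory.
Import numFieldNormedType.Exports.

Local Open Scope classical_set_scope.
Local Open Scope ring_scope.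
Local Open Scope ereal_scope.

(* Only the sigma-algebra of a Borel space is kept: [T] is measurably
   isomorphic to a Borel subset of a complete separable metric space. *)
Definition borel_space (R : realType) d (T : measurableType d) : Prop :=
  exists (X : completePseudoMetricType R) (f : T -> X),
    [/\ hausdorff_space X,
        exists2 D : set X, countable D & dense D,
        injective f,
        <<s @open X >> (range f) &
        @measurable d T = [set f @^-1` B | B in <<s @open X >>] ].

(* The integral against a signed measure is the difference of the integrals
   against its positive and negative variations; it does not depend on the Hahn
   decomposition that is picked. *)
Definition charge_integral (R : realType) d (T : measurableType d)
    (nu : {charge set T -> \bar R}) (f : T -> \bar R) : \bar R :=
  let: exist _ exN := cid (Hahn_decomposition nu) in
  let: exist _ nuPN := cid exN in
  \int[jordan_pos nuPN]_y f y - \int[jordan_neg nuPN]_y f y.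

(* [option T] is [T] with an isolated point [None] adjoined. *)
Definition option_display : measure_display -> measure_display.
Proof. exact. Qed.

Section measurable_option.
Context d (T : measurableType d).

Let option_measurable : set (set (option T)) :=
  [set B | measurable (Some @^-1` B)].

Let option_measurable0 : option_measurable set0.
Proof. by rewrite /option_measurable /= preimage_set0. Qed.

Let option_measurableC B : option_measurable B -> option_measurable (~` B).
Proof. by move=> mB; rewrite /option_measurable /= -preimage_setC; exact: measurableC. Qed.

Let option_measurableU (F : (set (option T))^nat) :
  (forall i, option_measurable (F i)) -> option_measurable (\bigcup_i F i).
Proof.
move=> mF; rewrite /option_measurable /= preimage_bigcup.
exact: bigcupT_measurable.
Qed.

HB.instance Definition _ := @isMeasurable.Build (option_display d) (option T)
  option_measurable option_measurable0 option_measurableC option_measurableU.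

End measurable_option.

(* Admissible pairs form [graph_set adm]; [rate] and [cost] are total functions
   whose values outside of it are irrelevant. *)
Definition graph_set (S A : Type) (adm : S -> set A) : set (S * A) :=
  [set p | adm p.1 p.2].

Record ctmdp (R : realType) dS dA (S : measurableType dS)
    (A : measurableType dA) := CTMDP {
  adm : S -> set A ;
  rate : S -> A -> {charge set S -> \bar R} ;
  cost : S -> A -> R ;
  discount : R ;
  adm_measurable : forall x, measurable (adm x) ;
  graph_measurable : measurable (graph_set adm) ;
  adm_selector : exists2 f : S -> A,
    measurable_fun setT f & forall x, adm x (f x) ;
  rate_measurable : forall G : set S, measurable G ->
    measurable_fun (graph_set adm) (fun p : S * A => rate p.1 p.2 G) ;
  rate_ge0 : forall x a, adm x a -> forall G : set S, measurable G ->
    0 <= rate x a (G `\ x) ;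
  rate_conservative : forall x a, adm x a -> rate x a setT = 0 ;
  rate_stable : forall x,
    ereal_sup [set - rate x a [set x] | a in adm x] < +oo ;
  cost_measurable :
    measurable_fun (graph_set adm) (fun p : S * A => cost p.1 p.2) ;
  discount_gt0 : (0 < discount)%R }.

Section model.
Context (R : realType) dS dA (S : measurableType dS) (A : measurableType dA).
Variable M : ctmdp R S A.

Definition exit_rate (x : S) : \bar R :=
  ereal_sup [set - rate M x a [set x] | a in adm M x].

Definition adm_ext (x : option S) : set (option A) :=
  if x is Some y then Some @` adm M y else [set None].

Definition rate_ext (x : option S) (a : option A) (G : set S) : \bar R :=
  if x is Some y then if a is Some a' then rate M y a' G else 0 else 0.

Definition cost_ext (x : option S) (a : option A) : R :=
  if x is Some y then if a is Some a' then cost M y a' else 0%R else 0%R.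

End model.

(* A trajectory (x_0, theta_1, x_1, theta_2, x_2, ...) is given by [init] = x_0
   and [step l] = (theta_{l+1}, x_{l+1}). *)
Definition jump_step (R : realType) (S : Type) (s : \bar R * option S) : Prop :=
  0 < s.1 < +oo /\ s.2 <> None.

Definition valid_steps (R : realType) (S : Type)
    (s : nat -> \bar R * option S) : Prop :=
  (forall l, jump_step (s l)) \/
  (exists n, (forall l, (l < n)%N -> jump_step (s l)) /\
             (forall l, (n <= l)%N -> s l = (+oo, None))).

Record trajectory (R : realType) (S : Type) := Trajectory {
  init : S ;
  step : nat -> \bar R * option S ;
  step_valid : valid_steps step }.

Lemma absorbed_valid (R : realType) (S : Type) :
  valid_steps (fun=> (+oo, None) : \bar R * option S).
Proof. by right; exists 0%N. Qed.

HB.instance Definition _ (R : realType) (S : Type) :=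
  gen_eqMixin (trajectory R S).
HB.instance Definition _ (R : realType) (S : Type) :=
  gen_choiceMixin (trajectory R S).
HB.instance Definition _ (R : realType) (S : pointedType) :=
  isPointed.Build (trajectory R S) (Trajectory point (absorbed_valid R S)).

Definition trajectory_display : measure_display -> measure_display.
Proof. exact. Qed.

Definition coordinate_sets (R : realType) d (S : measurableType d) :
    set (set (trajectory R S)) :=
  preimage_set_system setT (@init R S) measurable `|`
  \bigcup_l preimage_set_system setT
    ((@step R S) ^~ l : trajectory R S -> \bar R * option S) measurable.

HB.instance Definition _ (R : realType) d (S : measurableType d) :=
  @isMeasurable.Build (trajectory_display d) (trajectory R S)
    <<s @coordinate_sets R d S >>
    (@sigma_algebra0 _ setT (@coordinate_sets R d S))
    (@sigma_algebraC _ (@coordinate_sets R d S))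
    (@sigma_algebra_bigcup _ setT (@coordinate_sets R d S)).

Section process.
Context (R : realType) d (S : measurableType d).
Implicit Types (omega : trajectory R S) (t s : R).

Definition state omega (m : nat) : option S :=
  if m is l.+1 then (step omega l).2 else Some (init omega).

Definition jump_time omega (m : nat) : \bar R :=
  \sum_(l < m) (step omega l).1.

Definition explosion_time omega : \bar R := limn (jump_time omega).

(* The intervals [T_m, T_{m+1}[ partition [0, T_oo[, so that at most one state
   qualifies, and none does (hence the value is [None]) when t >= T_oo. *)
Definition xi omega t : option S :=
  xget None [set x | exists m,
    jump_time omega m <= t%:E < jump_time omega m.+1 /\ x = state omega m].

(* Same with ]T_m, T_{m+1}]; in particular the value is [None] for
   t >= T_oo, including at the accumulation point t = T_oo. *)
Definition xi_left omega t : option S :=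
  if t == 0%R then Some (init omega) else
  xget None [set x | exists m,
    jump_time omega m < t%:E <= jump_time omega m.+1 /\ x = state omega m].

Definition filtration t : set (set (trajectory R S)) :=
  <<s [set E | exists s m (G : set S), [/\ (0 <= s <= t)%R, measurable G &
        E = [set omega | jump_time omega m <= s%:E /\
                         (Some @` G) (state omega m)]]] >>.

Definition filtration_left s : set (set (trajectory R S)) :=
  <<s \bigcup_(t in `[0%R, s[) filtration t >>.

Definition predictable : set (set (trajectory R S * R)) :=
  <<s [set p | (0 <= p.2)%R],
      [set G `*` [set 0%R] | G in filtration 0%R] `|`
      [set E | exists s G, [/\ (0 <= s)%R, filtration_left s G &
                               E = G `*` [set u | (s < u)%R]]] >>.

(* h_m = (x_0, theta_1, x_1, ..., theta_m, x_m) *)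
Definition hist (m : nat) := (S * m.-tuple (\bar R * option S))%type.

Definition history m omega : hist m :=
  (init omega, [tuple step omega (val l) | l < m]).

(* (theta_m, x_m), with theta_0 := 0 *)
Definition last_step m (h : hist m) : \bar R * option S :=
  last (0, Some h.1) h.2.

End process.

Section control.
Context (R : realType) dS dA (S : measurableType dS) (A : measurableType dA).
Variable M : ctmdp R S A.

(* Times are real numbers: the values of [action_law] at t < 0 are irrelevant. *)
Record policy := Policy {
  action_law :> trajectory R S -> R -> probability (option A) R ;
  policy_predictable : forall B : set (option A), measurable B ->
    forall Y : set (\bar R), measurable Y ->
    predictable [set p | (0 <= p.2)%R /\ Y (action_law p.1 p.2 B)] ;
  policy_adm : forall omega t, (0 <= t)%R ->
    action_law omega t (adm_ext M (xi_left omega t)) = 1 }.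

(* The family of the non-random kernels pi^m(da | h_m, u) *)
Definition kernel_family :=
  forall m, R.-pker (hist R S m * R)%type ~> option A.

Definition represents (pi : policy) (k : kernel_family) : Prop :=
  forall m omega t,
    jump_time omega m < t%:E <= jump_time omega m.+1 ->
    forall B : set (option A), measurable B ->
    pi omega t B = k m (history m omega, (t - fine (jump_time omega m))%R) B.

Definition jump_intensity (k : kernel_family) m (h : hist R S m) (u : R)
    (G : set S) : \bar R :=
  let x := (last_step h).2 in
  \int[k m (h, u)]_(a in adm_ext M x)
    rate_ext M x a (G `\` [set y | Some y = x]).

(* The conditional law of (theta_{m+1}, x_{m+1}) given h_m. It lives on
   (]0, +oo[ x S) together with the point (+oo, None). *)
Definition jump_law (k : kernel_family) m (h : hist R S m)
    (C : set (\bar R * option S)) : \bar R :=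
  if (last_step h).1 == +oo then \d_((+oo, None) : \bar R * option S) C else
  \int[lebesgue_measure]_(u in `]0%R, +oo[)
    (jump_intensity k h u [set y | C (u%:E, Some y)] *
     expeR (- \int[lebesgue_measure]_(v in `]0%R, u])
                jump_intensity k h v setT))
  + expeR (- \int[lebesgue_measure]_(v in `]0%R, +oo[)
               jump_intensity k h v setT)
    * \d_((+oo, None) : \bar R * option S) C.

(* [strategic_measure gamma pi P] says that P is P_gamma^pi. The kernels [k m]
   are determined by [pi] at every (h_m, u) that starts a trajectory with
   theta_m < oo and u > 0, so [strategic_measure] does not depend on their
   choice. *)
Definition strategic_measure (gamma : probability S R) (pi : policy)
    (P : probability (trajectory R S) R) : Prop :=
  exists k : kernel_family, [/\ represents pi k,
    forall G : set S, measurable G -> P (@init R S @^-1` G) = gamma G &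
    forall m (B : set (hist R S m)) (C : set (\bar R * option S)),
      measurable B -> measurable C ->
      P ((history m @^-1` B) `&` [set omega | C (step omega m)]) =
      \int[P]_(omega in history m @^-1` B) jump_law k (history m omega) C].

Definition performance (pi : policy) (P : probability (trajectory R S) R) :
    \bar R :=
  \int[P]_omega \int[lebesgue_measure]_(t in `[0%R, +oo[)
    ((expR (- discount M * t))%:E *
     \int[pi omega t]_(a in adm_ext M (xi_left omega t))
       (cost_ext M (xi_left omega t) a)%:E).

End control.

(* Main.v *)
Require Import Defs.
From HB Require Import structures.
From mathcomp Require Import all_boot all_order all_algebra.
From mathcomp Require Import all_classical all_reals all_analysis.
From mathcomp Require Import measurable_realfun ring lra.
Set Implicit Arguments.
Unset Strict Implicit.
Unset Printing Implicit Defensive.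
Import Order.TTheory GRing.Theory Num.Theory.
Import numFieldNormedType.Exports.
Local Open Scope classical_set_scope.
Local Open Scope ring_scope.
Local Open Scope ereal_scope.

(** Put [wt x = w x + b / rho]. If [q_x] denotes the jump part of the rate, i.e.
    its restriction to the complement of [x], the drift condition reads
    [\int wt dq_x <= (rho + q_x(S)) * wt x]: the shift absorbs the constant [b]
    ([jump_rate_shifted_drift]). Given the history, the waiting time has a hazard
    rate [lam] and, as
    [\int_0^oo (lam u + rho) e^{- rho u} e^{- \int_0^u lam} du <= 1],
    one jump does not increase the expectation of [e^{- rho T_m} wt(x_m)]. This
    sequence is therefore a supermartingale ([discounted_weight_le]), and the
    three claims follow from it or from variants of the same one-step estimate.

    Non-explosion ([nonexplosion]). Let [G = {w <= N}] and
    [e_m = E[e^{- rho T_m}; x_0 \in G]]. The one-step estimate with the constant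
    1 in place of [wt] shows that one jump from a state with exit rate at most
    [K] multiplies the discount factor by at most [K / (K + rho)] on average;
    hence [e_{m+1}] is at most [e_m] minus [rho / (K + rho)] times the part of
    [e_m] with [x_m \in Sl l], where [K] bounds the rates on [Sl l]
    ([discounted_contraction]). These parts are thus summable over [m]. The part
    with [x_m] outside [Sl l] is at most
    [(N + b / rho) / inf_{x \notin Sl l} w x] by the supermartingale property,
    which is small for large [l]. So [e_m] tends to 0 ([discounted_small]). Now
    [e^{- rho T_m} >= e^{- rho n}] for every [m] when the explosion time is at
    most [n], so that this event is null; let [n] and [N] grow.

    Moment bound ([stopped_weight_le], [expected_weight_le]). Stop the process at a
    fixed time [t]. By the one-step estimate, the expectation of
    [e^{- rho T_m} wt(x_m)] on [T_m <= t] is at least that of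
    [e^{- rho T_{m+1}} wt(x_{m+1})] on [T_{m+1} <= t] plus that of
    [e^{- rho t} wt(x_m)] on [T_m <= t < T_{m+1}]. Summing over [m] gives
    [E[wt(xi_t)] <= e^{rho t} E[wt(x_0)]], and [b / rho] is subtracted on both
    sides because [xi_t] is almost surely a state.

    Performance bound. The running cost at time [t] is at least
    [- (Mc * w(xi_{t-}) + c)] ([action_cost_ge]); Tonelli's theorem
    ([integral_state_before]) and the moment bound for [xi_{t-}] reduce the claim
    to integrals of exponentials.

    All this presupposes that expectations of functions of the first [m + 1]
    steps can be computed by first integrating the last step, i.e. that
    [jump_law] is a kernel ([jump_kernel], [step_expectation]). The critical
    point is the joint measurability of [(x, a) |-> q(G \ {x} | x, a)]; it is here
    that a Borel space is used, through a sequence of measurable sets that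
    separates its points ([borel_space_separating], [measurable_jump_rate]). *)

(** * Integrals and measurability *)

(** The integral of a nonnegative function is a supremum over the simple
    functions below it, which is monotone for arbitrary functions. *)
Lemma le_integral_nonmeasurable d (T : measurableType d) (R : realType)
    (mu : {measure set T -> \bar R}) (D : set T) (f g : T -> \bar R) :
  (forall x, D x -> 0 <= f x) -> (forall x, D x -> f x <= g x) ->
  \int[mu]_(x in D) f x <= \int[mu]_(x in D) g x.
Proof.
move=> f0 fg; rewrite !ge0_integralE//; last first.
  by move=> x Dx; exact: le_trans (f0 x Dx) (fg x Dx).
apply: le_ereal_sup => _ [s sf <-]; exists s => // x.
exact: le_trans (sf x) (lee_restrict fg x).
Qed.

(** Only the negative part of [f] matters, and it lies below [h]. *)
Lemma integral_ge_opp d (T : measurableType d) (R : realType)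
    (mu : {measure set T -> \bar R}) (D : set T) (f h : T -> \bar R) :
  (forall x, D x -> 0 <= h x) -> (forall x, D x -> - h x <= f x) ->
  - (\int[mu]_(x in D) h x) <= \int[mu]_(x in D) f x.
Proof.
move=> h0 hf; rewrite [leRHS]integralE.
apply: (@le_trans _ _ (- (\int[mu]_(x in D) f^\- x))); last first.
  by rewrite leeDr// integral_ge0.
rewrite leeN2; apply: le_integral_nonmeasurable => x Dx //.
by rewrite funenegE ge_max h0// andbT leeNl hf.
Qed.

Lemma integral_cst_prob d (T : measurableType d) (R : realType)
    (P : probability T R) (c : R) : \int[P]_x (cst c%:E) x = c%:E.
Proof.
rewrite (integral_cst P measurableT) [X in _ * X](_ : _ = 1) ?mule1//.
exact: probability_setT.
Qed.

Lemma ge0_integral_mrestr d (T : measurableType d) (R : realType)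
    (m : {measure set T -> \bar R}) (D : set T) (mD : measurable D)
    (g : T -> \bar R) : measurable_fun setT g -> (forall x, 0 <= g x) ->
  \int[mrestr m mD]_x g x = \int[m]_(x in D) g x.
Proof.
move=> mg g0; rewrite -(setUv D) ge0_integral_setU//=.
- rewrite [X in _ + X](_ : _ = 0) ?adde0.
    apply: eq_measure_integral => A mA AD.
    by rewrite /= /mrestr (setIidl AD).
  rewrite (@eq_measure_integral _ _ _ _ mzero) ?integral_measure_zero//.
  move=> A mA AD; rewrite /= /mrestr [X in m X](_ : _ = set0) ?measure0//.
  by apply/seteqP; split => // x [/AD].
- exact: measurableC.
- by rewrite setUv.
- exact/disj_setPCl.
Qed.

Lemma measurable_asbool d (T : measurableType d) (P : set T) :
  measurable P -> measurable_fun setT (fun x => `[< P x >]).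
Proof.
move=> mP; apply: (@measurable_fun_bool _ _ _ _ true).
rewrite setTI (_ : _ @^-1` _ = P)//.
by apply/seteqP; split => x /= /asboolP.
Qed.

Lemma emeasurable_lt (R : realType) (y : \bar R) : measurable [set s | s < y].
Proof.
rewrite (_ : [set s | s < y] = `]-oo, y[%classic); first exact: emeasurable_itv.
by apply/seteqP; split => s; rewrite /= in_itv.
Qed.

Lemma emeasurable_le (R : realType) (y : \bar R) : measurable [set s | s <= y].
Proof.
rewrite (_ : [set s | s <= y] = `]-oo, y]%classic); first exact: emeasurable_itv.
by apply/seteqP; split => s; rewrite /= in_itv.
Qed.

Section option_measurability.
Context d (T : measurableType d).

Lemma measurable_Some : measurable_fun setT (@Some T).
Proof. by move=> _ B mB; rewrite setTI. Qed.

Lemma measurable_fun_option d' (Y : measurableType d') (f : option T -> Y) :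
  measurable_fun setT (f \o Some) -> measurable_fun setT f.
Proof. by move=> mf _ B mB; have := mf measurableT B mB; rewrite !setTI. Qed.

Lemma measurable_isSome : measurable_fun setT (@isSome T).
Proof. by apply: measurable_fun_option; exact: measurable_cst. Qed.

Lemma measurable_odflt (x : T) : measurable_fun setT (odflt x).
Proof. by apply: measurable_fun_option; exact: measurable_id. Qed.

End option_measurability.

(** * The exponential discount factor *)

Lemma measurable_expeR (R : realType) : measurable_fun setT (@expeR R).
Proof.
rewrite (_ : @expeR R = fun x => if x == -oo then 0 else er_map expR x).
  apply: measurable_fun_ifT => //; last first.
    by apply: (@measurable_er_map _ (measurableTypeR R) R expR).
  exact: measurable_fun_eqe.
by apply/funext => -[r| |].
Qed.

Lemma expeRN_real (R : realType) (x : \bar R) : 0 <= x ->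
  exists2 r : R, (0 <= r <= 1)%R & expeR (- x) = r%:E.
Proof.
case: x => [x|_|//]; last by exists 0%R => //; rewrite lexx ler01.
rewrite lee_fin => x0; exists (expR (- x)) => //.
by rewrite expR_ge0 -expR0 ler_expR oppr_le0.
Qed.

Definition discount_factor (R : realType) (rho : R) (t : \bar R) : \bar R :=
  expeR (- (rho%:E * t)).

Lemma discount_factorE (R : realType) (rho u : R) :
  discount_factor rho u%:E = (expR (- (rho * u)))%:E.
Proof. by []. Qed.

Lemma discount_factor_pinfty (R : realType) (rho : R) : (0 < rho)%R ->
  discount_factor rho +oo = 0.
Proof. by move=> rho0; rewrite /discount_factor gt0_muley. Qed.

Lemma discount_factor_ge0 (R : realType) (rho : R) t : 0 <= discount_factor rho t.
Proof. exact: expeR_ge0. Qed.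

Lemma measurable_discount_factor (R : realType) (rho : R) :
  measurable_fun setT (discount_factor rho).
Proof.
apply: measurableT_comp; first exact: measurable_expeR.
by apply: measurableT_comp => //; exact: measurable_funeM.
Qed.

Lemma discount_factorD (R : realType) (rho : R) (x y : \bar R) : (0 < rho)%R ->
  0 <= x -> 0 <= y ->
  discount_factor rho (x + y) = discount_factor rho x * discount_factor rho y.
Proof.
move=> rho0 x0 y0; rewrite /discount_factor -expeRD ge0_muleDr// oppeD//.
by rewrite ge0_adde_def// inE mule_ge0// lee_fin ltW.
Qed.

(** * Laplace transform of a waiting time with bounded hazard rate *)

Lemma set_itvoc0 (R : realType) (x : R) : `]x, x]%classic = set0 :> set R.
Proof. by rewrite set_itv_ge// bnd_simp ltxx. Qed.

(** Here [x] and [y] are the survival probabilities at the two ends of an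
    interval on which the cumulated hazard grows by [D], and [g] is the
    probability of a jump in this interval: to first order in [D], [g = x - y]. *)
Lemma survival_increment (R : realType) (x y D g : R) :
  (0 <= x)%R -> (x <= 1)%R -> (0 <= D)%R -> y = (x * expR (- D))%R ->
  (y * D <= g)%R -> (g <= x * D)%R -> (`|y - x + g| <= D ^+ 2)%R.
Proof.
move=> x0 x1 D0 yE lo hi.
have y0 : (0 <= y)%R by rewrite yE mulr_ge0// expR_ge0.
have xE : x = (y * expR D)%R by rewrite yE -mulrA -expRD addNr expR0 mulr1.
have up : (x - y <= x * D)%R.
  by have := ler_wpM2l x0 (expR_ge1Dx (- D)); rewrite -yE; lra.
have lw : (y * D <= x - y)%R.
  by have := ler_wpM2l y0 (expR_ge1Dx D); rewrite -xE; lra.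
have gap : ((x - y) * D <= D ^+ 2)%R.
  rewrite expr2 ler_wpM2r//; apply: le_trans up _.
  by rewrite ler_piMl.
move: gap; rewrite mulrBl => gap.
rewrite ler_norml; apply/andP; split; lra.
Qed.

Section hazard.
Context (R : realType).
Notation mu := (@lebesgue_measure R).

(** Cutting the interval from 0 to [s] into [n] equal pieces bounds the total increment by
    [C * s ^+ 2 / n]. *)
Lemma quadratic_increment_cst (H : R -> R) (C s : R) : (0 <= s)%R ->
  (forall u v, 0 <= u -> u <= v -> `|H v - H u| <= C * (v - u) ^+ 2)%R ->
  H s = H 0%R.
Proof.
move=> s0 HC; apply/eqP; rewrite -subr_eq0 -normr_eq0; apply: contraT => a0.
have {}a0 : (0 < `|H s - H 0|)%R by rewrite lt_neqAle eq_sym a0 normr_ge0.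
(* After [i] of the [n.+1] pieces the error is at most [i] times that of one piece. *)
set a := `|_|%R in a0.
have step n i : (i <= n.+1)%N ->
    (`|H (i%:R * (s / n.+1%:R)) - H 0| <= i%:R * (C * (s / n.+1%:R) ^+ 2))%R.
  elim: i => [_|i IH ilt]; first by rewrite !mul0r subrr normr0.
  set e := (s / n.+1%:R)%R.
  have e0 : (0 <= e)%R by rewrite divr_ge0.
  have -> : (H (i.+1%:R * e) - H 0 =
      (H (i.+1%:R * e) - H (i%:R * e)) + (H (i%:R * e) - H 0))%R by ring.
  apply: (le_trans (ler_normD _ _)).
  rewrite -[in leRHS]natr1 [leRHS]mulrDl mul1r addrC lerD //.
    exact: (IH (ltnW ilt)).
  apply: (le_trans (HC _ _ _ _)).
  - by rewrite mulr_ge0.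
  - by rewrite ler_wpM2r// ler_nat.
  - by rewrite -natr1 mulrDl mul1r addrAC subrr add0r.
have {}step n : (a <= C * s ^+ 2 / n.+1%:R)%R.
  apply: le_trans (le_trans (step n n.+1 (leqnn _)) _).
    by rewrite mulrCA mulfV ?pnatr_eq0// mulr1.
  have : (n.+1%:R != 0 :> R)%R by rewrite pnatr_eq0.
  move: (n.+1%:R : R)%R => N N0.
  by rewrite le_eqVlt; apply/orP; left; apply/eqP; field.
have /(_ (C * s ^+ 2 / a)%R) := @Num.Theory.archi_boundP R.
have C0 : (0 <= C * s ^+ 2)%R.
  have := step 0%N; rewrite divr1; exact/le_trans/ltW.
move=> /(_ (divr_ge0 C0 (ltW a0))); set n := Num.bound _ => nlt.
have := step n; apply: contraLR => _; rewrite -ltNge.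
rewrite ltr_pdivrMr// [ltRHS]mulrC -ltr_pdivrMr//.
by apply: lt_le_trans nlt _; rewrite ler_nat.
Qed.

Variables (lam : R -> R) (K : R).
Hypothesis mlam : measurable_fun setT lam.
Hypothesis lam0 : forall u, (0 <= lam u)%R.
Hypothesis lamK : forall u, (lam u <= K)%R.

Lemma ge0_integral_itvD (f : R -> \bar R) (u v : R) :
  measurable_fun setT f -> (forall x, 0 <= f x) ->
  (0 <= u)%R -> (u <= v)%R ->
  \int[mu]_(x in `]0%R, v]) f x =
  \int[mu]_(x in `]0%R, u]) f x + \int[mu]_(x in `]u, v]) f x.
Proof.
move=> mf f0 u0 uv.
rewrite -ge0_integral_setU//=.
- by rewrite -itv_bndbnd_setU// bnd_simp.
- exact: measurable_funTS.
- apply/disj_setPS => x [] /=; rewrite !in_itv/= => /andP[_ xu] /andP[ux _].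
  by move: (lt_le_trans ux xu); rewrite ltxx.
Qed.

Let mlamE : measurable_fun setT (EFin \o lam).
Proof. exact/measurable_EFinP. Qed.

Lemma integral_bounded_le (u v : R) : (u <= v)%R ->
  \int[mu]_(x in `]u, v]) (lam x)%:E <= (K * (v - u))%:E.
Proof.
move=> uv; apply: (@le_trans _ _ (\int[mu]_(x in `]u, v]) (cst K%:E) x)).
  apply: ge0_le_integral => //=.
  - by move=> x _; rewrite lee_fin.
  - exact: measurable_funTS.
  - by move=> x _; rewrite lee_fin.
rewrite integral_cst//= lebesgue_measure_itv/= lte_fin.
by case: ltgtP uv => // -> _; rewrite mule0 subrr mulr0.
Qed.

Lemma integral_bounded_fin (u v : R) : (u <= v)%R ->
  \int[mu]_(x in `]u, v]) (lam x)%:E \is a fin_num.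
Proof.
move=> uv; rewrite ge0_fin_numE; last by apply: integral_ge0 => x _; rewrite lee_fin.
exact: le_lt_trans (integral_bounded_le uv) (ltry _).
Qed.

(** Along the hazard [lam], [F s] is the cumulated hazard at time [s], [E s] the
    survival probability and [G s] the probability of a jump before [s]. *)
Let F (s : R) : R := fine (\int[mu]_(v in `]0%R, s]) (lam v)%:E).

Let FE s : (0 <= s)%R -> \int[mu]_(v in `]0%R, s]) (lam v)%:E = (F s)%:E.
Proof. by move=> s0; rewrite fineK// integral_bounded_fin. Qed.

Lemma ge0_integral_ocitv_ge0 u v : 0 <= \int[mu]_(x in `]u, v]) (lam x)%:E.
Proof. by apply: integral_ge0 => x _; rewrite lee_fin. Qed.

Let F_ge0 s : (0 <= F s)%R.
Proof. exact/fine_ge0/ge0_integral_ocitv_ge0. Qed.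

Let FD u v : (0 <= u)%R -> (u <= v)%R ->
  \int[mu]_(x in `]u, v]) (lam x)%:E = (F v - F u)%:E.
Proof.
move=> u0 uv; have v0 := le_trans u0 uv.
have := ge0_integral_itvD mlamE (fun x => lam0 x) u0 uv.
rewrite !FE//.
by rewrite -(fineK (integral_bounded_fin uv)) -EFinD => -[->]; congr EFin; ring.
Qed.

Let F_nd u v : (u <= v)%R -> (F u <= F v)%R.
Proof.
move=> uv; rewrite /F.
have [u0|u0] := leP 0%R u.
  rewrite -/(F u) -/(F v) -subr_ge0 -lee_fin -FD//.
  exact: ge0_integral_ocitv_ge0.
rewrite [X in fine X](_ : _ = 0); first exact: F_ge0.
by rewrite set_itv_ge ?integral_set0// bnd_simp -leNgt ltW.
Qed.

Let E (s : R) : R := expR (- F s).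

Let mE : measurable_fun setT E.
Proof.
apply: measurableT_comp => //; apply: measurableT_comp => //.
by apply: nondecreasing_measurable => // u v _ _; exact: F_nd.
Qed.

Let E_ni u v : (u <= v)%R -> (E v <= E u)%R.
Proof. by move=> uv; rewrite ler_expR lerN2 F_nd. Qed.

Let E_gt0 s : (0 < E s)%R. Proof. exact: expR_gt0. Qed.
Let E_ge0 s : (0 <= E s)%R. Proof. exact: expR_ge0. Qed.
Let E_le1 s : (E s <= 1)%R.
Proof. by rewrite -expR0 ler_expR oppr_le0. Qed.

Let mlamEE : measurable_fun setT (fun u => (lam u * E u)%:E).
Proof. by apply/measurable_EFinP; exact: measurable_funM. Qed.

Let lamEE_ge0 u : 0 <= (lam u * E u)%:E.
Proof. by rewrite lee_fin mulr_ge0// ltW. Qed.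

Let G (s : R) : R := fine (\int[mu]_(v in `]0%R, s]) (lam v * E v)%:E).

Let G_bound u v : (0 <= u)%R -> (u <= v)%R ->
  (E v * (F v - F u))%:E <= \int[mu]_(x in `]u, v]) (lam x * E x)%:E
     <= (E u * (F v - F u))%:E.
Proof.
move=> u0 uv; apply/andP; split; rewrite EFinM -FD//.
  rewrite -ge0_integralZl_EFin//=; last 2 first.
  - by move=> x _; rewrite lee_fin.
  - exact: measurable_funTS.
  apply: ge0_le_integral => //=.
  - by move=> x _; rewrite -EFinM lee_fin mulr_ge0// ltW.
  - by apply: measurable_funTS; apply: emeasurable_funM => //; exact: measurable_cst.
  - exact: measurable_funTS.
  - move=> x; rewrite in_itv/= => /andP[_ xv].
    by rewrite -EFinM lee_fin mulrC; apply: ler_wpM2l (E_ni xv).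
rewrite -ge0_integralZl_EFin//=; last 2 first.
- by move=> x _; rewrite lee_fin.
- exact: measurable_funTS.
apply: ge0_le_integral => //=.
- exact: measurable_funTS.
- by apply: measurable_funTS; apply: emeasurable_funM => //; exact: measurable_cst.
- move=> x; rewrite in_itv/= => /andP[ux _].
  by rewrite -EFinM lee_fin mulrC; apply: ler_wpM2r (E_ni (ltW ux)).
Qed.

Let G_fin u v : (0 <= u)%R -> (u <= v)%R ->
  \int[mu]_(x in `]u, v]) (lam x * E x)%:E \is a fin_num.
Proof.
move=> u0 uv; rewrite ge0_fin_numE; last exact: integral_ge0.
by have /andP[_ /le_lt_trans->//] := G_bound u0 uv; rewrite ltry.
Qed.

Let GD u v : (0 <= u)%R -> (u <= v)%R ->
  \int[mu]_(x in `]u, v]) (lam x * E x)%:E = (G v - G u)%:E.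
Proof.
move=> u0 uv; have v0 := le_trans u0 uv.
have := ge0_integral_itvD mlamEE lamEE_ge0 u0 uv.
rewrite -(fineK (G_fin u0 uv)) -(fineK (G_fin (lexx _) u0)).
rewrite -(fineK (G_fin (lexx _) v0)) -/(G u) -/(G v) -EFinD => -[->].
by congr EFin; ring.
Qed.

(** The density [lam e^{- \int lam}] of the waiting time is the derivative of
    minus the survival probability wherever [lam] is continuous. As [lam] is
    merely measurable and bounded, it is shown instead that the survival
    probability plus the integral of the density has quadratically small
    increments. *)
Lemma integral_hazard s : (0 <= s)%R ->
  \int[mu]_(u in `]0%R, s])
     ((lam u)%:E * expeR (- \int[mu]_(v in `]0%R, u]) (lam v)%:E)) =
  1 - expeR (- \int[mu]_(v in `]0%R, s]) (lam v)%:E).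
Proof.
move=> s0; rewrite FE//=.
rewrite [LHS](_ : _ = \int[mu]_(u in `]0%R, s]) (lam u * E u)%:E); last first.
  apply: eq_integral => u; rewrite inE/= in_itv/= => /andP[u0 _].
  by rewrite FE// ltW.
rewrite GD// -EFinB; congr EFin; rewrite -/(E s).
have F00 : F 0%R = 0%R by rewrite /F set_itvoc0 integral_set0.
have G00 : G 0%R = 0%R by rewrite /G set_itvoc0 integral_set0.
suff : (E s + G s = E 0 + G 0)%R.
  have E00 : E 0%R = 1%R by rewrite /E F00 oppr0 expR0.
  by rewrite G00 subr0 addr0 E00 => <-; rewrite [X in (X - _)%R]addrC addrK.
apply: (@quadratic_increment_cst (fun x => E x + G x)%R (K ^+ 2)) => // u v u0 uv.
have /andP[] := G_bound u0 uv; rewrite GD// !lee_fin => lo hi.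
have D0 : (0 <= F v - F u)%R by rewrite subr_ge0 F_nd.
have DK : (F v - F u <= K * (v - u))%R.
  by rewrite -lee_fin -FD//; exact: integral_bounded_le.
set D := (F v - F u)%R in lo hi D0 DK.
have Ev : E v = (E u * expR (- D))%R by rewrite /E -expRD -opprD addrC subrK.
have D2 : (D ^+ 2 <= K ^+ 2 * (v - u) ^+ 2)%R.
  by rewrite -exprMn; rewrite ler_pXn2r// nnegrE// (le_trans D0 DK).
apply: le_trans D2; rewrite opprD addrACA.
exact: (survival_increment (E_ge0 u) (E_le1 u) D0 Ev lo hi).
Qed.

Lemma survival_real s : exists2 e : R, (0 <= e <= 1)%R &
  expeR (- \int[mu]_(v in `]0%R, s]) (lam v)%:E) = e%:E.
Proof.
exists (E s); first by rewrite ltW//= E_le1.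
have [s0|s0] := leP 0%R s; first by rewrite FE.
by rewrite /E /F set_itv_ge ?integral_set0 ?oppe0 ?oppr0// bnd_simp -leNgt ltW.
Qed.

Lemma measurable_survival : measurable_fun setT
  (fun s : R => expeR (- \int[mu]_(v in `]0%R, s]) (lam v)%:E)).
Proof.
rewrite (_ : (fun s => _) = EFin \o E); first exact/measurable_EFinP.
apply/funext => s /=; have [s0|s0] := leP 0%R s; first by rewrite FE.
by rewrite /E /F set_itv_ge ?integral_set0 ?oppe0 ?oppr0// bnd_simp -leNgt ltW.
Qed.

End hazard.

(** Monotone convergence along the bounded intervals; [r] allows to ignore the
    short ones and [c] is an additional mass that sits at infinity. *)
Lemma ge0_integral_oyitv_le (R : realType) (f : R -> \bar R) (c : \bar R) (C r : R) :
  measurable_fun setT f -> (forall x, 0 <= f x) -> 0 <= c ->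
  (forall s : R, (0 <= s)%R -> (r <= s)%R ->
     \int[lebesgue_measure]_(x in `]0%R, s]) f x + c <= C%:E) ->
  \int[lebesgue_measure]_(x in `]0%R, +oo[) f x + c <= C%:E.
Proof.
move=> mf f0 c0 H.
have Ifin s : (0 <= s)%R -> (r <= s)%R ->
    \int[lebesgue_measure]_(x in `]0%R, s]) f x <= C%:E - c.
  move=> s0 rs; have := H _ s0 rs; case: c c0 {H} => [c c0|_|]//.
    by rewrite leeBrDr.
  by rewrite addey ?gt_eqF// (lt_le_trans _ (integral_ge0 _ _)).
have cC : c <= C%:E.
  have := H (Num.max r 0%R); rewrite !le_max !lexx orbT/= => /(_ isT isT).
  by apply: le_trans; rewrite leeDr// integral_ge0.
have cfin : c \is a fin_num by rewrite ge0_fin_numE// (le_lt_trans cC (ltry _)).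
rewrite -leeBrDr//.
rewrite itv_bndy_bigcup_BRight.
have cvgI := @ge0_nondecreasing_set_cvg_integral _ (measurableTypeR R) R
  (fun n => [set` Interval (BRight 0%R) (BRight (0 + n%:R)%R)]) f lebesgue_measure.
apply: (cvge_le _ (cvgI _ _ _ _)).
- near=> n; rewrite add0r Ifin//.
  by near: n; exact: nbhs_infty_ger.
- move=> m n mn; apply/subsetPset => x /=; rewrite !in_itv/= !add0r.
  move=> /andP[-> /= /le_trans->//].
  by rewrite ler_nat.
- by move=> n; exact: measurable_itv.
- by move=> n; exact: measurable_funTS.
- by move=> *; exact: f0.
Unshelve. all: by end_near. Qed.

Section hazard_laplace.
Context (R : realType) (lam : R -> R) (K : R).
Notation mu := (@lebesgue_measure R).
Hypothesis mlam : measurable_fun setT lam.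
Hypothesis lam0 : forall u, (0 <= lam u)%R.
Hypothesis lamK : forall u, (lam u <= K)%R.

Let S (u : R) := expeR (- \int[mu]_(v in `]0%R, u]) (lam v)%:E).

Let S0 u : 0 <= S u. Proof. exact: expeR_ge0. Qed.

Variable beta : R.
Hypothesis beta0 : (0 <= beta)%R.

Let integral_cst_ocitv u : (0 <= u)%R ->
  \int[mu]_(v in `]0%R, u]) beta%:E = (beta * u)%:E.
Proof.
move=> u0; rewrite integral_cst//= lebesgue_measure_itv/= lte_fin.
by move: u0; rewrite le_eqVlt => /predU1P[<-|->]; rewrite ?ltxx ?mule0 ?mulr0 ?sube0.
Qed.

(** Killing at the constant rate [beta] turns the hazard [lam] into
    [lam + beta] and the survival probability [S] into [S u * e^{- beta u}], so
    this is [integral_hazard] for the new rate. *)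
Lemma integral_hazard_laplace r : (0 <= r)%R ->
  \int[mu]_(u in `]0%R, r]) (S u * ((lam u + beta) * expR (- (beta * u)))%:E) =
  1 - S r * (expR (- (beta * r)))%:E.
Proof.
have SE u : (0 <= u)%R -> expeR (- \int[mu]_(v in `]0%R, u]) (lam v + beta)%:E) =
    S u * (expR (- (beta * u)))%:E.
  move=> u0; under eq_integral do rewrite EFinD.
  rewrite ge0_integralD//=; last 2 first.
  - by move=> v _; rewrite lee_fin.
  - exact/measurable_EFinP/measurable_funTS.
  rewrite integral_cst_ocitv//.
  rewrite (_ : (expR (- (beta * u)))%:E = expeR (- (beta * u)%:E))// -expeRD.
  by rewrite oppeD// fin_num_adde_defl.
move=> r0; rewrite -SE//.
rewrite -(@integral_hazard _ (fun u => lam u + beta)%R (K + beta)%R)//.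
- apply: eq_integral => u; rewrite inE/= in_itv/= => /andP[u0 _].
  by rewrite SE ?ltW// [RHS]muleCA EFinM.
- exact: measurable_funD.
- by move=> u; rewrite addr_ge0.
- by move=> u; rewrite lerD2r.
Qed.

Let mS : measurable_fun setT S.
Proof. exact: measurable_survival mlam lam0 lamK. Qed.

Let mS_laplace : measurable_fun setT
  (fun u => S u * ((lam u + beta) * expR (- (beta * u)))%:E).
Proof.
apply: emeasurable_funM => //; apply/measurable_EFinP; apply: measurable_funM.
  exact: measurable_funD.
by apply: measurableT_comp => //; apply: measurableT_comp.
Qed.

Lemma integral_hazard_laplace_le1 :
  \int[mu]_(u in `]0%R, +oo[) (S u * ((lam u + beta) * expR (- (beta * u)))%:E)
  <= 1.
Proof.
rewrite -[leLHS]adde0; apply: (@ge0_integral_oyitv_le _ _ _ _ 0%R) => //.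
  by move=> u; rewrite mule_ge0// lee_fin mulr_ge0 ?expR_ge0// addr_ge0.
move=> s s0 _; rewrite integral_hazard_laplace// adde0.
have [e /andP[e0 e1]] := survival_real mlam lam0 lamK s; rewrite -/(S s) => ->.
by rewrite -EFinM -EFinB lee_fin gerBl mulr_ge0// expR_ge0.
Qed.

Let integral_hazard_ocitv r s : (0 <= r)%R -> (r <= s)%R ->
  \int[mu]_(u in `]r, s]) (S u * (lam u)%:E) = S r - S s.
Proof.
move=> r0 rs; have s0 := le_trans r0 rs.
have mf : measurable_fun setT (fun u => (lam u)%:E * S u).
  by apply: emeasurable_funM => //; exact/measurable_EFinP.
have f0 u : 0 <= (lam u)%:E * S u by rewrite mule_ge0// lee_fin.
under eq_integral do rewrite muleC.
have := ge0_integral_itvD mf f0 r0 rs.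
rewrite !(integral_hazard mlam lam0 lamK)// -!/(S _).
have [x _] := survival_real mlam lam0 lamK r; rewrite -/(S r) => ->.
have [y _] := survival_real mlam lam0 lamK s; rewrite -/(S s) => ->.
have : 0 <= \int[mu]_(u in `]r, s]) ((lam u)%:E * S u) by exact: integral_ge0.
case: (\int[mu]_(u in `]r, s]) _) => [z| |] _//.
by rewrite -!EFinB -EFinD => -[yxz]; congr EFin; lra.
Qed.

(** The version of the previous estimate for a process stopped at time [r]:
    after [r] the discount factor is frozen and [beta] stops contributing. *)
Lemma integral_hazard_stopped_le1 r : (0 <= r)%R ->
  \int[mu]_(u in `]0%R, +oo[) (S u *
     (if (u <= r)%R then (lam u + beta) * expR (- (beta * u))
      else lam u * expR (- (beta * r)))%:E)
  + expeR (- \int[mu]_(v in `]0%R, +oo[) (lam v)%:E) * (expR (- (beta * r)))%:E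
  <= 1.
Proof.
move=> r0; set g := (fun u => S u * _).
have mg : measurable_fun setT g.
  apply: emeasurable_funM => //; apply/measurable_EFinP.
  apply: measurable_fun_ifT => /=.
  - exact: measurable_fun_ler.
  - apply: measurable_funM; first exact: measurable_funD.
    by apply: measurableT_comp => //; apply: measurableT_comp.
  - exact: measurable_funM.
have g0 u : 0 <= g u.
  rewrite /g mule_ge0// lee_fin; case: ifPn => _.
    by rewrite mulr_ge0 ?expR_ge0// addr_ge0.
  by rewrite mulr_ge0// expR_ge0.
apply: (@ge0_integral_oyitv_le _ _ _ _ r) => //.
  by rewrite mule_ge0// ?expeR_ge0// lee_fin expR_ge0.
move=> s s0 rs.
rewrite (ge0_integral_itvD mg g0 r0 rs).
have -> : \int[mu]_(x in `]0%R, r]) g x = 1 - S r * (expR (- (beta * r)))%:E.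
  rewrite -integral_hazard_laplace//; apply: eq_integral => u.
  by rewrite inE/= in_itv/= /g => /andP[_ ->].
have -> : \int[mu]_(x in `]r, s]) g x = (expR (- (beta * r)))%:E * (S r - S s).
  rewrite -integral_hazard_ocitv// -ge0_integralZl_EFin ?expR_ge0//.
  - apply: eq_integral => u; rewrite inE/= in_itv/= /g => /andP[ru _].
    by rewrite leNgt ru/= EFinM muleA muleC.
  - by move=> u _; rewrite mule_ge0// lee_fin.
  - by apply: measurable_funTS; apply: emeasurable_funM => //; exact/measurable_EFinP.
have : expeR (- \int[mu]_(v in `]0%R, +oo[) (lam v)%:E) <= S s.
  rewrite /S lee_expeR leeN2; apply: ge0_subset_integral => //.
  - by apply/measurable_EFinP; exact: measurable_funTS.
  - by move=> u _; rewrite lee_fin.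
  - by move=> u /=; rewrite !in_itv/= => /andP[->].
have : 0 <= expeR (- \int[mu]_(v in `]0%R, +oo[) (lam v)%:E) by exact: expeR_ge0.
have [x _] := survival_real mlam lam0 lamK r; rewrite -/(S r) => ->.
have [y _] := survival_real mlam lam0 lamK s; rewrite -/(S s) => ->.
case: (expeR _) => [z| |]//; rewrite !lee_fin => z0 zy.
by have := ler_wpM2l (expR_ge0 (- (beta * r))) zy; rewrite mulrBr; lra.
Qed.

End hazard_laplace.

Lemma integral_expR_decay (R : realType) (beta : R) : (0 < beta)%R ->
  \int[lebesgue_measure]_(t in `]0%R, +oo[) (expR (- (beta * t)))%:E = (beta^-1)%:E.
Proof.
move=> beta0.
have mE : measurable_fun setT (fun t : R => (expR (- (beta * t)))%:E).
  apply/measurable_EFinP; apply: measurableT_comp => //.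
  by apply: measurableT_comp => //; exact: measurable_funM.
rewrite integral_itv_obnd_cbnd; last exact: measurable_funTS.
have : (beta%:E * \int[lebesgue_measure]_(t in `[0%R, +oo[) (expR (- (beta * t)))%:E = 1)%E.
  rewrite -(integral_exponential_pdf beta0) -ge0_integralZl_EFin ?(ltW beta0)//; last first.
    exact: measurable_funTS.
  rewrite integral_mkcond; apply: eq_integral => t _.
  rewrite /exponential_pdf !patchE; case: ifP => // _.
  by rewrite -EFinM mulNr.
case: (\int[lebesgue_measure]_(t in `[0%R, +oo[) _) => [z [bz]| |].
- by congr EFin; rewrite -[RHS]mulr1 -bz mulKf// gt_eqF.
- by rewrite gt0_muley.
- by rewrite gt0_muleNy.
Qed.

Lemma integral_expR_decayD (R : realType) (beta1 beta2 p q : R) :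
  (0 < beta1)%R -> (0 < beta2)%R ->
  \int[lebesgue_measure]_(t in `]0%R, +oo[)
    (p * expR (- (beta1 * t)) + q * expR (- (beta2 * t)))%:E =
  (p / beta1 + q / beta2)%:E.
Proof.
move=> b1 b2.
have int (beta : R) : (0 < beta)%R -> lebesgue_measure.-integrable `]0%R, +oo[
    (fun t => (expR (- (beta * t)))%:E).
  move=> beta0; apply/integrableP; split.
    apply: measurable_funTS; apply/measurable_EFinP.
    apply: measurableT_comp => //.
    by apply: measurableT_comp => //; exact: measurable_funM.
  under eq_integral do rewrite gee0_abs ?lee_fin ?expR_ge0//.
  by rewrite integral_expR_decay// ltry.
under eq_integral do rewrite EFinD 2!EFinM.
rewrite integralD//; last 2 first.
- by apply: integrableZl => //; exact: int.
- by apply: integrableZl => //; exact: int.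
rewrite !integralZl//; [|exact: int..].
by rewrite !integral_expR_decay.
Qed.

(** * Kernels *)

Section kpullback.
Context d d' d3 (X : measurableType d) (Y : measurableType d')
  (Z : measurableType d3) (R : realType).
Variable f : X -> Y.

(** The measurability of [f] is an argument of the kernel so that its
    kernel instances can be found from the term alone. *)
Definition kpullback (mf : measurable_fun setT f)
  (k : Y -> {measure set Z -> \bar R}) (x : X) : {measure set Z -> \bar R} :=
  k (f x).

Hypothesis mf : measurable_fun setT f.

Section ker.
Variable k : R.-ker Y ~> Z.
Let kpullback_measurable U : measurable U ->
  measurable_fun setT (kpullback mf k ^~ U).
Proof.
by move=> mU; exact: measurableT_comp (measurable_kernel k U mU) mf.
Qed.
HB.instance Definition _ :=
  isKernel.Build _ _ _ _ _ (kpullback mf k) kpullback_measurable.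
End ker.

Variable k : R.-sfker Y ~> Z.

Let kpullback_sfinite : exists2 s : (R.-ker X ~> Z)^nat,
  forall n, measure_fam_uub (s n) &
  forall x U, measurable U -> kpullback mf k x U = kseries s x U.
Proof.
have [s ks] := sfinite_kernel k.
exists (fun n => kpullback mf (s n)) => [n|x U mU].
  by have [r sr] := measure_uub (s n); exists r => x; exact: sr.
exact: ks.
Qed.

HB.instance Definition _ :=
  isSFiniteKernel_subdef.Build _ _ _ _ _ (kpullback mf k) kpullback_sfinite.

End kpullback.

Section kwdirac.
Context d d' (X : measurableType d) (Y : measurableType d') (R : realType).
Variables (e : X -> R) (f : X -> Y).
Hypotheses (e0 : forall x, (0 <= e x)%R) (e1 : forall x, (e x <= 1)%R).
Hypotheses (me : measurable_fun setT e) (mf : measurable_fun setT f).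

(** The kernel that puts mass [e x] at the point [f x]. As the instances
    declared below rest on the hypotheses under the [let], these have to occur in
    the term. *)
Definition kwdirac (x : X) : {measure set Y -> \bar R} :=
  let _ := (e1, me, mf) in mscale (NngNum (e0 x)) (\d_(f x)).

Let kwdirac_measurable U : measurable U -> measurable_fun setT (kwdirac ^~ U).
Proof.
move=> mU; apply: emeasurable_funM; first exact/measurable_EFinP.
rewrite (_ : (fun x => _) = (fun x => (\1_U (f x))%:E)); last first.
  by apply/funext => x; rewrite /= diracE indicE.
apply/measurable_EFinP; apply: measurableT_comp mf.
exact: measurable_indic.
Qed.

HB.instance Definition _ := isKernel.Build _ _ _ _ _ kwdirac kwdirac_measurable.

Let kwdirac_le1 : ereal_sup [set kwdirac x [set: Y] | x in setT] <= 1.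
Proof.
apply: ge_ereal_sup => _ [x _ <-].
by rewrite /kwdirac /= /mscale/= diracT mule1 lee_fin.
Qed.

HB.instance Definition _ :=
  Kernel_isSubProbability.Build _ _ _ _ _ kwdirac kwdirac_le1.

Lemma integral_kwdirac x (g : Y -> \bar R) : measurable_fun setT g ->
  (forall y, 0 <= g y) -> \int[kwdirac x]_y g y = (e x)%:E * g (f x).
Proof.
move=> mg g0; rewrite /kwdirac ge0_integral_mscale// integral_dirac//.
by rewrite diracT mul1e.
Qed.

End kwdirac.

Section kpos_lebesgue.
Context d (X : measurableType d) (R : realType).

Let idR : measurableTypeR R -> R := idfun.

Let measurable_idR : measurable_fun setT idR.
Proof. by move=> _ Y mY; rewrite setTI. Qed.

Let unit_itv (n : nat) : set (measurableTypeR R) := `[n%:R, n.+1%:R[%classic.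

Let measurable_unit_itv n : measurable (unit_itv n).
Proof. exact: measurable_itv. Qed.

Let unit_measure n : {measure set (measurableTypeR R) -> \bar R} :=
  mrestr (@lebesgue_measure R) (measurable_unit_itv n).

(** Lebesgue measure on the interval from [n] to [n + 1], moved from the measurable type of reals
    that carries it to the Borel sigma-algebra of [R]. *)
Definition unit_lebesgue (n : nat) (_ : X) : {measure set R -> \bar R} :=
  measure_function_pushforward__canonical__measure_function_Measure
    (unit_measure n) measurable_idR.

Let unit_lebesgue_measurable n U : measurable U ->
  measurable_fun setT (unit_lebesgue n ^~ U).
Proof. by move=> mU; exact: measurable_cst. Qed.

HB.instance Definition _ n :=
  isKernel.Build _ _ _ _ _ (unit_lebesgue n) (@unit_lebesgue_measurable n).

Let unit_lebesgue_finite n : measure_fam_uub (unit_lebesgue n).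
Proof.
exists 2%R => x; rewrite /unit_lebesgue/= /pushforward/=.
rewrite /mrestr setTI lebesgue_measure_itv/=.
by rewrite lte_fin ltr_nat ltnSn -EFinB -natrB// subSnn lte_fin ltr_nat.
Qed.

HB.instance Definition _ n :=
  Kernel_isFinite.Build _ _ _ _ _ (unit_lebesgue n) (@unit_lebesgue_finite n).

(** Lebesgue measure on the half-line as a constant kernel: the measurability
    of parametric integrals and the composition theorem for s-finite kernels are
    then available for integrals over time. *)
Definition kpos_lebesgue : R.-sfker X ~> R :=
  kseries (fun n => unit_lebesgue n : R.-sfker X ~> R).

Lemma integral_kpos_lebesgue x (g : R -> \bar R) : measurable_fun setT g ->
  (forall y, 0 <= g y) ->
  \int[kpos_lebesgue x]_y g y = \int[lebesgue_measure]_(y in `]0%R, +oo[) g y.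
Proof.
move=> mg g0; rewrite integral_kseries//=.
rewrite [RHS]integral_itv_obnd_cbnd; last exact: measurable_funTS.
rewrite (@eq_eseriesr _ _ (fun i => \int[lebesgue_measure]_(y in unit_itv i) g y));
  last first.
  move=> i _; rewrite /unit_lebesgue ge0_integral_pushforward//=.
  exact: ge0_integral_mrestr.
have -> : `[0%R, +oo[%classic = \bigcup_n `[n%:R, n.+1%:R[%classic :> set R.
  apply/seteqP; split => [r|r [n _]] /=; rewrite !in_itv/= andbT.
    by move=> r0; exists (Num.truncn r) => //=; rewrite in_itv/= truncn_itv.
  by move=> /andP[nr _]; exact: le_trans nr.
rewrite ge0_integral_bigcup//.
- exact: measurable_funTS.
- apply/trivIsetP => i j _ _ ij; apply/seteqP; split => // r [] /=.
  rewrite !in_itv/= => ri rj; move: ij.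
  by rewrite -(truncn_def ri) -(truncn_def rj) eqxx.
Qed.
End kpos_lebesgue.

(** * Separating sequences of sets and shrinking cells *)

Section separating.
Context (R : realType) d (T : measurableType d).

Definition separating (E : nat -> set T) :=
  forall x y, (forall n, E n x -> E n y) -> x = y.

(** Pull back the balls of radius [1 / (k + 1)] around the points of a countable
    dense set. *)
Lemma borel_space_separating : borel_space R T ->
  exists2 E : nat -> set T, forall n, measurable (E n) & separating E.
Proof.
move=> [X [f [hX [D cD dD] finj _ mT]]].
have [code code_inj] := countable_injP _ cD.
pose B (d0 : X) (k : nat) : set X := (ball d0 k.+1%:R^-1)°.
pose E0 (p : nat * nat) : set T := f @^-1`
  (\bigcup_(d0 in [set d0 | D d0 /\ code d0 = p.1]) B d0 p.2).
pose E i := if @unpickle (nat * nat)%type i is Some p then E0 p else set0.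
have mE0 p : measurable (E0 p).
  rewrite mT; eexists; last reflexivity.
  apply: sub_sigma_algebra; apply: bigcup_open => d0 _.
  exact: open_interior.
exists E => [n|x y Exy].
  by rewrite /E; case: unpickle => [p|]; [exact: mE0|exact: measurable0].
apply: finj; apply: hX => U V /nbhs_ballP[eU /= eU0 xU] /nbhs_ballP[eV /= eV0 yV].
(* A ball of radius [1 / k.+1] around a dense point near [f x] fits in both
   neighbourhoods; the set of index [(code d0, k)] contains [x], hence [y]. *)
pose e := Num.min eU eV.
have e0 : (0 < e)%R by rewrite lt_min eU0.
have [k ke] : exists k, (k.+1%:R^-1 < e)%R.
  have [k _ k0] := near_infty_natSinv_lt (PosNum e0).
  by exists k; exact: (k0 k (leqnn k)).
pose de := (k.+1%:R^-1 : R)%R.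
have de0 : (0 < de)%R by rewrite invr_gt0.
have half0 : (0 < de / 2)%R by rewrite divr_gt0.
have [d0 [/interior_subset xd Dd]] : (ball (f x) (de / 2))° `&` D !=set0.
  apply: dD; last exact: open_interior.
  by exists (f x); exact: (nbhsx_ballx _ _ half0).
have inB : B d0 k (f x).
  rewrite /B /interior /=; apply: filterS (nbhsx_ballx (f x) _ half0) => z xz.
  rewrite -/de (splitr de); apply: ball_triangle xz.
  exact: ball_sym.
have : E (pickle (code d0, k)) y.
  apply: Exy; rewrite /E pickleK; exists d0 => //.
rewrite /E pickleK => -[d1 /= [Dd1 code1] /interior_subset yd].
have dd : d1 = d0 by apply: code_inj => //; exact: mem_set.
rewrite {}dd in yd.
exists d0; split.
  apply: xU; apply: le_ball xd; rewrite ler_pdivrMr//.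
  move: ke; rewrite /e lt_min -/de => /andP[/ltW h _].
  by apply: le_trans h _; rewrite ler_peMr ?ler1n// ltW.
apply: yV; apply: le_ball (ball_sym yd).
by move: ke; rewrite /e lt_min -/de => /andP[_ /ltW].
Qed.

Lemma separating_measurable_set1 (E : nat -> set T) :
  (forall n, measurable (E n)) -> separating E -> forall x, measurable ([set x] : set T).
Proof.
move=> mE sE x.
rewrite (_ : [set x] = \bigcap_(n in [set n | E n x]) E n).
  exact: bigcap_measurableType.
by apply/seteqP; split => [y -> n|y yE]//; apply/esym/sE => n; exact: yE.
Qed.

End separating.

(** The cell of [x] collects the points that are not distinguished from [x] by
    those of the first [n] sets which contain [x]; for a separating sequence the
    cells shrink to [x]. *)
Fixpoint cell T (E : nat -> set T) (n : nat) (x : T) : set T :=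
  if n is k.+1 then
    if `[< E k x >] then cell E k x `&` E k else cell E k x
  else setT.

Section cell.
Context d (T : measurableType d) (E : nat -> set T).
Hypotheses (mE : forall n, measurable (E n)) (sE : separating E).

Lemma measurable_cell n x : measurable (cell E n x).
Proof.
elim: n => [|n IH] /=; first exact: measurableT.
by case: asboolP => // _; exact: measurableI.
Qed.

Lemma cell_self n x : cell E n x x.
Proof. by elim: n => [|n IH] //=; case: asboolP. Qed.

Lemma cell_decr n m x : (n <= m)%N -> cell E m x `<=` cell E n x.
Proof.
elim: m => [|m IH]; first by rewrite leqn0 => /eqP->.
rewrite leq_eqVlt => /predU1P[->//|/IH h] /=.
by case: asboolP => _ // y [/h].
Qed.

Lemma bigcup_setD_cell (G : set T) x : \bigcup_n (G `\` cell E n x) = G `\ x.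
Proof.
apply/seteqP; split => y.
  by move=> [n _ [Gy ny]]; split => //= yx; apply: ny; rewrite yx; exact: cell_self.
move=> [Gy /= yx]; apply: contrapT => H; apply: yx; apply/esym/sE => n Enx.
apply: contrapT => Eny; apply: H; exists n.+1 => //; split => //=.
by case: asboolP => // _ [].
Qed.

End cell.

(** * The jump part of the transition rate *)

Section jump_rate.
Context (R : realType) dS dA (S : measurableType dS) (A : measurableType dA).
Variable M : ctmdp R S A.
Hypothesis mS1 : forall x, measurable ([set x] : set S).

Section pointwise.
Variables (x : S) (a : A).

(** The jump part of the rate, set to 0 outside of the admissible pairs and of
    the measurable sets so that it is a measure for every [x] and [a]. The [let]
    makes the hypothesis on singletons, on which countable additivity rests,
    part of the term, for the sake of instance inference. *)
Definition jump_rate (G : set S) : \bar R :=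
  let _ := mS1 in
  if `[< adm M x a /\ measurable G >] then rate M x a (G `\ x) else 0.

Lemma jump_rateE G : adm M x a -> measurable G ->
  jump_rate G = rate M x a (G `\ x).
Proof. by move=> xa mG; rewrite /jump_rate; case: asboolP => // -[]. Qed.

Let jump_rate0 : jump_rate set0 = 0.
Proof. by rewrite /jump_rate set0D charge0 if_same. Qed.

Let jump_rate_ge0 G : 0 <= jump_rate G.
Proof. by rewrite /jump_rate; case: asboolP => // -[xa mG]; exact: rate_ge0. Qed.

Let jump_rate_additive : semi_sigma_additive jump_rate.
Proof.
move=> F mF tF mUF; rewrite /jump_rate.
have [xa|nxa] := pselect (adm M x a); last first.
  case: asboolP => [[]//|_].
  rewrite (_ : (fun n => _) = cst 0); first exact: cvg_cst.
  by apply/funext => n; rewrite big1// => i _; case: asboolP => // -[].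
case: asboolP => [_|[]//].
under eq_fun do under eq_bigr => i _ do rewrite (asboolT (conj xa (mF i))).
rewrite setD_bigcupl; apply: charge_semi_sigma_additive.
- by move=> i; apply: measurableD.
- by apply: trivIset_setIr => i j _ _ /=; exact: tF.
- by rewrite -setD_bigcupl; exact: measurableD.
Qed.

HB.instance Definition _ := isMeasure.Build _ _ _ jump_rate
  jump_rate0 jump_rate_ge0 jump_rate_additive.

End pointwise.

Lemma jump_rateT x a : adm M x a -> jump_rate x a setT = - rate M x a [set x].
Proof.
move=> xa; rewrite jump_rateE// setTD.
have := rate_conservative xa.
rewrite -(setUv [set x]) chargeU//; last 2 first.
- exact: measurableC.
- exact: setICr.
have f1 : rate M x a [set x] \is a fin_num by exact: fin_num_measure.
have f2 : rate M x a (~` [set x]) \is a fin_num.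
  by apply: fin_num_measure; exact: measurableC.
rewrite -(fineK f1) -(fineK f2) -EFinD => -[/eqP]; rewrite addrC addr_eq0.
by move=> /eqP ->.
Qed.

(** The selector is used at the states [x] where [a] is not admissible: there
    the left-hand side is 0, and the supremum on the right is nonnegative because
    it runs over a nonempty set. *)
Lemma jump_rateT_le x a : jump_rate x a setT <= exit_rate M x.
Proof.
have [xa|nxa] := pselect (adm M x a).
  by rewrite jump_rateT//; apply: ereal_sup_ubound; exists a.
have [f _ fadm] := adm_selector M.
rewrite {1}/jump_rate; case: asboolP => [[]//|_].
apply: le_trans (ereal_sup_ubound _); last by exists (f x).
by rewrite -jump_rateT.
Qed.

Variable E : nat -> set S.
Hypotheses (mE : forall n, measurable (E n)) (sE : separating E).

(** The sets [G `&` cell E n x] depend on [x] only through finitely many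
    measurable tests, so that [rate x a (G `&` cell E n x)] is measurable in
    [(x, a)] by induction on [n]; then [G `\ x] is the increasing union of the
    sets [G `\` cell E n x]. *)
Lemma measurable_jump_rate (G : set S) : measurable G ->
  measurable_fun setT (fun z : S * A => jump_rate z.1 z.2 G).
Proof.
move=> mG; have mgr := graph_measurable M.
rewrite (_ : (fun z => _) =
    (fun z => rate M z.1 z.2 (G `\ z.1)) \_ (graph_set (adm M))); last first.
  apply/funext => z; rewrite patchE; case: ifPn => [/set_mem zM|/negP zM].
    by rewrite jump_rateE.
  by rewrite /jump_rate; case: asboolP => // -[zM' _]; case: zM; exact: mem_set.
apply/(measurable_restrictT _ mgr).
have mcell n : forall G, measurable G -> measurable_fun (graph_set (adm M))
    (fun z : S * A => rate M z.1 z.2 (G `&` cell E n z.1)).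
  elim: n => [|n IH] {mG}G mG /=.
    by under eq_fun do rewrite setIT; exact: rate_measurable.
  rewrite (_ : (fun z => _) = fun z => if `[< E n z.1 >]
      then rate M z.1 z.2 (G `&` E n `&` cell E n z.1)
      else rate M z.1 z.2 (G `&` cell E n z.1)); last first.
    by apply/funext => z; case: ifP => // _; rewrite [cell _ _ _ `&` _]setIC setIA.
  apply: measurable_fun_if => //.
  - apply: measurable_funTS.
    exact: (measurableT_comp (measurable_asbool (mE n)) measurable_fst).
  - by apply: measurable_funS (IH _ _) => //; exact: measurableI.
  - by apply: measurable_funS (IH _ _).
apply: (@emeasurable_fun_cvg _ _ _ _
  (fun n z => rate M z.1 z.2 (G `\` cell E n z.1))).
  move=> n; rewrite (_ : (fun z => _) = (fun z : S * A => rate M z.1 z.2 G -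
     rate M z.1 z.2 (G `&` cell E n z.1))); last first.
    by apply/funext => z; rewrite chargeD//; exact: measurable_cell.
  by apply: emeasurable_funB; [exact: rate_measurable|exact: mcell].
move=> [x a] /= xa.
have mD n : measurable (G `\` cell E n x).
  by apply: measurableD => //; exact: measurable_cell.
have nd : nondecreasing_seq (fun n => G `\` cell E n x).
  by move=> n m nm; apply/subsetPset; apply: setDS; exact: cell_decr.
have mG1 : measurable (G `\ x) by exact: measurableD.
have h : rate M x a (G `\ x) = jump_rate x a (\bigcup_n (G `\` cell E n x)).
  by rewrite bigcup_setD_cell// jump_rateE// setDDl setUid.
rewrite h.
rewrite (_ : (fun n => _) = jump_rate x a \o (fun n => G `\` cell E n x)).
  by apply: nondecreasing_cvg_mu => //; rewrite bigcup_setD_cell.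
apply/funext => n /=; rewrite jump_rateE//; congr (rate M x a _).
by rewrite setDDl; congr (_ `\` _); apply/esym/setUidl => _ ->; exact: cell_self.
Qed.

Section extended.
Variable Sl : nat -> set S.
Hypotheses (mSl : forall l, measurable (Sl l)) (Sl_cover : \bigcup_l Sl l = setT).
Hypothesis rate_bounded :
  forall l, ereal_sup [set exit_rate M x | x in Sl l] < +oo.

(** The jump part of the rate on the extended states and actions. All hypotheses
    of the section are put in the term since the proof that this kernel is
    s-finite uses them. *)
Definition option_jump_rate (p : option S * option A) :
    {measure set S -> \bar R} :=
  let _ := (mE, sE, mSl, Sl_cover, rate_bounded) in
  match p with (Some x, Some a) => jump_rate x a | _ => mzero end.

Lemma option_jump_rateT_le x a :
  option_jump_rate (Some x, a) setT <= exit_rate M x.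
Proof.
case: a => [a|] /=; first exact: jump_rateT_le.
by have [f _ _] := adm_selector M; exact: le_trans (measure_ge0 _ _) (jump_rateT_le x (f x)).
Qed.

Let measurable_option_jump_rate (G : set S) : measurable G ->
  measurable_fun setT (option_jump_rate ^~ G).
Proof.
move=> mG; rewrite (_ : (fun p => _) = fun p : option S * option A =>
    if isSome p.1 && isSome p.2
    then jump_rate (odflt point p.1) (odflt point p.2) G else 0); last first.
  by apply/funext => -[[x|] [a|]].
apply: measurable_fun_ifT => //.
- by apply: measurable_and; apply: measurableT_comp => //;
    exact: measurable_isSome.
- apply: (measurableT_comp (measurable_jump_rate mG)
    (g := fun p : option S * option A => (odflt point p.1, odflt point p.2))).
  by apply: measurable_fun_pair => /=; apply: measurableT_comp => //;
    exact: measurable_odflt.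
Qed.

HB.instance Definition _ :=
  isKernel.Build _ _ _ _ _ option_jump_rate measurable_option_jump_rate.

(** The sets [Sl l] made disjoint: the rates are bounded on each layer, which cuts
    the kernel into a sequence of finite ones. *)
Let layer n : set (option S) := Some @` seqDU Sl n.

Let measurable_layer n : measurable (layer n).
Proof.
rewrite /measurable/= (_ : Some @^-1` _ = seqDU Sl n).
  exact: seqDU_measurable.
by apply/seteqP; split => x /=; [move=> [y ? [<-]]|exists x].
Qed.

Let layered n (p : option S * option A) : {measure set S -> \bar R} :=
  if `[< layer n p.1 >] then option_jump_rate p else mzero.

Let layeredE n p U : layered n p U =
  if `[< layer n p.1 >] then option_jump_rate p U else 0.
Proof. by rewrite /layered; case: asboolP. Qed.

Let measurable_layered n (G : set S) : measurable G ->
  measurable_fun setT (layered n ^~ G).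
Proof.
move=> mG; rewrite (_ : (fun p => _) = fun p : option S * option A =>
    if `[< layer n p.1 >] then option_jump_rate p G else 0); last first.
  by apply/funext => p; rewrite layeredE.
apply: measurable_fun_ifT => //.
- exact: (measurableT_comp (measurable_asbool (measurable_layer n)) measurable_fst).
- exact: measurable_option_jump_rate.
Qed.

HB.instance Definition _ n :=
  isKernel.Build _ _ _ _ _ (layered n) (@measurable_layered n).

Let option_jump_rate_sfinite : exists2 s : (R.-ker _ ~> _)^nat,
  forall n, measure_fam_uub (s n) &
  forall p U, measurable U -> option_jump_rate p U = kseries s p U.
Proof.
exists layered => [n|p U mU].
  have := rate_bounded n; set B := ereal_sup _ => Blt.
  have [r Br] : exists r : R, B < r%:E.
    case: B Blt => [r _|//|_]; last by exists 0%R; rewrite ltNyr.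
    by exists (r + 1)%R; rewrite lte_fin ltrDl.
  exists (Num.max r 1)%R => -[[x|] a]; rewrite layeredE; case: asboolP => //=.
  - move=> [y Dy [yx]]; rewrite {}yx in Dy; have Slx := subset_seqDU Dy; rewrite EFin_max lt_max; apply/orP; left.
    apply: le_lt_trans Br; apply: le_trans (option_jump_rateT_le x a) _.
    by apply: ereal_sup_ubound; exists x.
  - by rewrite lte_fin lt_max ltr01 orbT.
  - by rewrite lte_fin lt_max ltr01 orbT.
  - by rewrite lte_fin lt_max ltr01 orbT.
rewrite /kseries /= /mseries.
case: p => -[x|] a /=; last first.
  by rewrite eseries0// => i _ _; rewrite layeredE; case: asboolP => // -[].
have [n _ nx] : (\bigcup_n seqDU Sl n) x by rewrite -seqDU_bigcup_eq Sl_cover.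
rewrite (@nneseriesD1 _ _ n)//.
rewrite [X in _ + X]eseries0 ?adde0.
  by rewrite layeredE; case: asboolP => //= -[]; exists x.
move=> i _ /= ni; rewrite layeredE; case: asboolP => //= -[y iy [yx]].
rewrite {}yx in iy; have iSn : i = n.
  by apply: (@trivIset_seqDU _ Sl i n I I); exists x.
by rewrite iSn eqxx in ni.
Qed.

HB.instance Definition _ := isSFiniteKernel_subdef.Build _ _ _ _ _
  option_jump_rate option_jump_rate_sfinite.

End extended.
End jump_rate.

(** * Drift of the shifted weight *)

Section drift.
Context (R : realType) dS dA (S : measurableType dS) (A : measurableType dA).
Variable M : ctmdp R S A.
Hypothesis mS1 : forall x, measurable ([set x] : set S).
Local Notation jump_rate := (jump_rate M mS1).

(** In a Hahn decomposition the negative part of the rate lives on [x] up to a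
    null set, while the positive part dominates the jump part. *)
Lemma charge_integral_rate_ge x a (w : S -> R) : adm M x a ->
  measurable_fun setT w -> (forall y, 0 <= w y)%R ->
  \int[jump_rate x a]_y (w y)%:E - jump_rate x a setT * (w x)%:E <=
  charge_integral (rate M x a) (fun y => (w y)%:E).
Proof.
move=> xa mw w0; rewrite /charge_integral.
case: cid => P exN; case: cid => N PN /=.
have [posP negN PUN PIN] := PN.
have mP : measurable P by case: posP.
have mN : measurable N by case: negN.
have mew : measurable_fun setT (fun y => (w y)%:E) by exact/measurable_EFinP.
(* The set [N] is negative for the rate, which is nonnegative away from [x]. *)
have negN0 G : measurable G -> rate M x a ((G `\ x) `&` N) = 0.
  move=> mG; apply/eqP; rewrite eq_le; apply/andP; split.
    apply: (negN).2; last by apply: subIsetr.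
    by apply: measurableI => //; exact: measurableD.
  rewrite (_ : (G `\ x) `&` N = (G `&` N) `\ x); last by rewrite !setDE setIAC.
  by apply: rate_ge0 => //; exact: measurableI.
have negE G : measurable G -> jordan_neg PN G = - rate M x a (G `&` N).
  by move=> mG; rewrite jordan_negE cjordan_negE /crestr0 mem_set.
have posE G : measurable G -> jump_rate x a G = jordan_pos PN (G `\ x).
  move=> mG; rewrite jump_rateE// jordan_posE cjordan_posE /crestr0 mem_set; last first.
    exact: measurableD.
  rewrite /crestr (charge_partition _ _ mP mN PUN PIN); last exact: measurableD.
  by rewrite negN0// adde0.
apply: leeB.
  pose nx := ~` [set x].
  have mnx : measurable nx by exact: measurableC.
  rewrite (@eq_measure_integral _ _ _ _ (mrestr (jordan_pos PN) mnx)); last first.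
    by move=> G mG _; rewrite /= posE// /mrestr /nx setDE.
  rewrite ge0_integral_mrestr//.
  by apply: ge0_subset_integral => // y _; rewrite lee_fin.
have -> : \int[jordan_neg PN]_y (w y)%:E = (w x)%:E * jordan_neg PN [set x].
  rewrite -(setUv [set x]) ge0_integral_setU//=.
  - rewrite [X in _ + X](_ : _ = 0) ?adde0.
      rewrite -integral_cst//; apply: eq_integral => y.
      by rewrite inE/= => ->.
    rewrite (@eq_measure_integral _ _ _ _ mzero) ?integral_measure_zero// => G mG Gx.
    rewrite /= negE// -[in rate _ _ _ _](_ : G `\ x = G) ?negN0 ?oppe0//.
    by rewrite setDE setIidl.
  - exact: measurableC.
  - by rewrite setUv.
  - by move=> y _; rewrite lee_fin.
  - exact/disj_setPCl.
rewrite muleC lee_wpmul2r ?lee_fin//.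
rewrite negE// jump_rateT//.
have [xN|xN] := pselect (N x).
  by rewrite setIidl// => _ ->.
rewrite (_ : _ `&` N = set0) ?charge0 ?oppe0 -?jump_rateT//.
by apply/seteqP; split => // y [->].
Qed.

Variables (w : S -> R) (rho b : R).
Hypotheses (mw : measurable_fun setT w) (w_ge0 : forall x, (0 <= w x)%R).
Hypotheses (rho_gt0 : (0 < rho)%R) (b_ge0 : (0 <= b)%R).
Hypothesis drift : forall x a, adm M x a ->
  charge_integral (rate M x a) (fun y => (w y)%:E) <= (rho * w x + b)%:E.

(** The shift makes the drift condition homogeneous:
    [rho * w x + b = rho * shifted_weight x]. *)
Definition shifted_weight (x : S) : R := (w x + b / rho)%R.

Lemma shifted_weight_ge0 x : (0 <= shifted_weight x)%R.
Proof. by rewrite addr_ge0// divr_ge0// ltW. Qed.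

Lemma measurable_shifted_weight : measurable_fun setT shifted_weight.
Proof. exact: measurable_funD. Qed.

Lemma jump_rate_shifted_drift x a : adm M x a ->
  \int[jump_rate x a]_y (shifted_weight y)%:E <=
  (rho%:E + jump_rate x a setT) * (shifted_weight x)%:E.
Proof.
move=> xa.
have jfin : jump_rate x a setT \is a fin_num.
  by rewrite jump_rateT// fin_numN; exact: fin_num_measure.
have := le_trans (charge_integral_rate_ge xa mw w_ge0) (drift xa).
under [X in _ -> X <= _]eq_integral do rewrite EFinD.
rewrite ge0_integralD//; last 3 first.
- by move=> y _; rewrite lee_fin.
- exact/measurable_EFinP.
- by move=> y _; rewrite lee_fin divr_ge0// ltW.
rewrite integral_cst//=.
move: jfin; case: (jump_rate x a setT) => // j _.
rewrite leeBlDr// -EFinM -EFinD.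
case: (\int[jump_rate x a]_y (w y)%:E) => [z| |]//; last by move=> _; rewrite addNye leNye.
rewrite -!EFinD -EFinM !lee_fin /shifted_weight => h.
have -> : ((rho + j) * (w x + b / rho) = rho * w x + b + j * w x + b / rho * j)%R.
  by field; rewrite gt_eqF.
by lra.
Qed.

End drift.

(** * The conditional law of the next jump as a kernel *)

Section last_step_measurable.
Context (R : realType) d (S : measurableType d).

Lemma last_step_tnth m (h : hist R S m.+1) : last_step h = tnth h.2 ord_max.
Proof.
rewrite /last_step (tnth_nth (0, Some h.1)) /=.
by rewrite (last_nth (0, Some h.1)) size_tuple.
Qed.

Lemma measurable_last_step m : measurable_fun setT (@last_step R d S m).
Proof.
case: m => [|m].
  rewrite (_ : @last_step R d S 0 = fun h : hist R S 0 => (0, Some h.1)).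
    apply: measurable_fun_pair; first exact: measurable_cst.
    exact: measurableT_comp (@measurable_Some _ S) measurable_fst.
  by apply/funext => -[x t]; rewrite /last_step (tuple0 t).
rewrite (_ : @last_step R d S m.+1 = fun h => tnth h.2 ord_max).
  exact: measurableT_comp (measurable_tnth _) measurable_snd.
by apply/funext => h; exact: last_step_tnth.
Qed.

End last_step_measurable.

Section jump_kernel.
Context (R : realType) dS dA (S : measurableType dS) (A : measurableType dA).
Variable M : ctmdp R S A.
Hypothesis mS1 : forall x, measurable ([set x] : set S).
Variable E : nat -> set S.
Hypotheses (mE : forall n, measurable (E n)) (sE : separating E).
Variable Sl : nat -> set S.
Hypotheses (mSl : forall l, measurable (Sl l)) (Sl_cover : \bigcup_l Sl l = setT).
Hypothesis rate_bounded :
  forall l, ereal_sup [set exit_rate M x | x in Sl l] < +oo.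
Variable k : kernel_family R S A.
Variable m : nat.
Local Notation H := (hist R S m).
Local Notation step_t := (\bar R * option S)%type.

Let nu : R.-sfker (option S * option A) ~> S :=
  option_jump_rate mS1 mE sE mSl Sl_cover rate_bounded.

Let state_action (z : H * R * option A) : option S * option A :=
  ((last_step z.1.1).2, z.2).

Let measurable_state_action : measurable_fun setT state_action.
Proof.
apply: measurable_fun_pair; last exact: measurable_snd.
apply: measurableT_comp => //; apply: measurableT_comp.
  exact: measurable_last_step.
by apply: measurableT_comp.
Qed.

(** The measure [Lambda^m(dy | h, u)] of the model. *)
Definition intensity : R.-sfker (H * R) ~> S :=
  (k m : R.-sfker _ ~> _) \; (kpullback measurable_state_action nu : R.-sfker _ ~> _).

Lemma jump_intensityE h u G : measurable G ->
  jump_intensity M k h u G = intensity (h, u) G.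
Proof.
move=> mG; rewrite /jump_intensity /intensity /= /kcomp.
rewrite [LHS]integral_mkcond; apply: eq_integral => a _.
rewrite patchE /kpullback /state_action /=.
case: (last_step h).2 => [x|] /=; last by case: ifPn.
case: ifPn => [/set_mem [a' xa' <-]|/negP xa] /=.
  rewrite jump_rateE//; congr (rate M x a' _).
  by apply/seteqP; split => y [Gy /= ne]; split => //= e; apply: ne; [rewrite e|case: e].
case: a xa => // a xa; rewrite /= /jump_rate; case: asboolP => // -[xa' _].
by case: xa; apply/mem_set; exists a.
Qed.

Lemma intensityT_le h u x : (last_step h).2 = Some x ->
  intensity (h, u) setT <= exit_rate M x.
Proof.
move=> hx; rewrite /intensity /= /kcomp.
apply: (@le_trans _ _ (\int[k m (h, u)]_(a in setT) cst (exit_rate M x) a)).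
  apply: ge0_le_integral => //.
  - exact: (measurableT_comp (measurable_kernel
      (kpullback measurable_state_action nu : R.-sfker _ ~> _) _ measurableT)).
  - move=> a _; rewrite /kpullback /state_action /= hx.
    exact: (option_jump_rateT_le mS1 mE sE mSl Sl_cover rate_bounded).
by rewrite (integral_cst (k m (h, u)) measurableT) prob_kernel mule1.
Qed.

Definition hazard (h : H) (u : R) : \bar R :=
  \int[lebesgue_measure]_(v in `]0%R, u]) intensity (h, v) setT.

Definition total_hazard (h : H) : \bar R :=
  \int[lebesgue_measure]_(v in `]0%R, +oo[) intensity (h, v) setT.

Lemma hazard_ge0 h u : 0 <= hazard h u.
Proof. exact: integral_ge0. Qed.

Lemma total_hazard_ge0 h : 0 <= total_hazard h.
Proof. exact: integral_ge0. Qed.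

Let measurable_intensityT : measurable_fun setT (fun z : H * R => intensity z setT).
Proof. exact: measurable_kernel. Qed.

(** The upper limit of the time integral is moved into the integrand, which makes
    the hazard an integral of a jointly measurable function against a constant
    kernel. *)
Lemma measurable_hazard : measurable_fun setT (fun z : H * R => hazard z.1 z.2).
Proof.
rewrite (_ : (fun z => _) = fun z : H * R => \int[kpos_lebesgue _ R z]_v
    (if (v <= z.2)%R then intensity (z.1, v) setT else 0)).
  apply: (measurable_fun_integral_sfinite_kernel
    (fun zv : H * R * R => if (zv.2 <= zv.1.2)%R
        then intensity (zv.1.1, zv.2) setT else 0)) => /=.
    by move=> z; case: ifP.
  apply: measurable_fun_ifT => //.
    by apply: measurable_fun_ler => //; apply: measurableT_comp.
  apply: (measurableT_comp measurable_intensityT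
    (g := fun zv : H * R * R => (zv.1.1, zv.2))).
  by apply: measurable_fun_pair => //; apply: measurableT_comp.
apply/funext => -[h u] /=.
rewrite integral_kpos_lebesgue; last 2 first.
- apply: measurable_fun_ifT => //; first exact: measurable_fun_ler.
  exact: (measurableT_comp measurable_intensityT).
- by move=> v; case: ifP.
rewrite /hazard integral_mkcond [RHS]integral_mkcond.
apply: eq_integral => v _; rewrite !patchE !mem_setE !in_itv/= andbT.
by case: (0 < v)%R; case: (v <= u)%R.
Qed.

Lemma measurable_total_hazard : measurable_fun setT total_hazard.
Proof.
rewrite (_ : total_hazard = fun h => \int[kpos_lebesgue _ R h]_v intensity (h, v) setT).
  exact: (measurable_fun_integral_sfinite_kernel
    (fun z : H * R => intensity z setT)).
apply/funext => h; rewrite integral_kpos_lebesgue//.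
exact: (measurableT_comp measurable_intensityT).
Qed.

Let absorbed (h : H) : bool := (last_step h).1 == +oo.

Let measurable_absorbed : measurable_fun setT absorbed.
Proof.
apply: measurable_fun_eqe => //.
exact: measurableT_comp (@measurable_last_step _ _ _ _).
Qed.

Let jump_weight (z : H * R * S) : R :=
  if absorbed z.1.1 then 0%R else fine (expeR (- hazard z.1.1 z.1.2)).

Let jump_weight_ge0 z : (0 <= jump_weight z)%R.
Proof. by rewrite /jump_weight; case: ifP => // _; rewrite fine_ge0// expeR_ge0. Qed.

Let jump_weight_le1 z : (jump_weight z <= 1)%R.
Proof.
rewrite /jump_weight; case: ifP => // _.
by have [r /andP[_ r1] ->] := expeRN_real (hazard_ge0 z.1.1 z.1.2).
Qed.

Let measurable_jump_weight : measurable_fun setT jump_weight.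
Proof.
apply: measurable_fun_ifT => //.
  by apply: (measurableT_comp measurable_absorbed); exact: measurableT_comp.
apply: (measurableT_comp (f := fun z : H * R => fine (expeR (- hazard z.1 z.2)))) => //.
apply: measurableT_comp => //; apply: measurableT_comp; first exact: measurable_expeR.
by apply: measurableT_comp => //; exact: measurable_hazard.
Qed.

Let jump_target (z : H * R * S) : step_t := (z.1.2%:E, Some z.2).

Let measurable_jump_target : measurable_fun setT jump_target.
Proof.
apply: measurable_fun_pair.
  by apply/measurable_EFinP; exact: measurableT_comp.
by apply: measurableT_comp; first exact: measurable_Some.
Qed.

Let stay_weight (h : H) : R :=
  if absorbed h then 1%R else fine (expeR (- total_hazard h)).

Let stay_weight_ge0 h : (0 <= stay_weight h)%R.
Proof. by rewrite /stay_weight; case: ifP => // _; rewrite fine_ge0// expeR_ge0. Qed.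

Let stay_weight_le1 h : (stay_weight h <= 1)%R.
Proof.
rewrite /stay_weight; case: ifP => // _.
by have [r /andP[_ r1] ->] := expeRN_real (total_hazard_ge0 h).
Qed.

Let measurable_stay_weight : measurable_fun setT stay_weight.
Proof.
apply: measurable_fun_ifT => //.
apply: measurableT_comp => //; apply: measurableT_comp; first exact: measurable_expeR.
by apply: measurableT_comp => //; exact: measurable_total_hazard.
Qed.

Let stay_target (h : H) : step_t := (+oo, None).

Let measurable_stay_target : measurable_fun setT stay_target.
Proof. exact: measurable_cst. Qed.

(** Either a jump at a time [u] drawn from Lebesgue measure, to a state drawn from
    the intensity at [u] and weighted by the survival probability at [u], or no
    jump at all. After absorption, which an infinite last sojourn time indicates,
    the first weight is 0 and the second is 1. *)
Definition jump_kernel_def : R.-sfker H ~> step_t :=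
  kadd (kpos_lebesgue H R \; (intensity \; (kwdirac jump_weight_ge0
     jump_weight_le1 measurable_jump_weight measurable_jump_target
       : R.-sfker _ ~> _) : R.-sfker _ ~> _) : R.-sfker _ ~> _)
   (kwdirac stay_weight_ge0 stay_weight_le1 measurable_stay_weight
      measurable_stay_target).

Lemma jump_kernel_sig : {J : R.-sfker H ~> step_t | J = jump_kernel_def}.
Proof. by exists jump_kernel_def. Qed.

(** Sealed by a sigma type: from here on only the integrals against this kernel
    matter, and its definition is too deep to be compared by unfolding. *)
Definition jump_kernel : R.-sfker H ~> step_t := sval jump_kernel_sig.

Lemma integral_jump_kernel h (g : step_t -> \bar R) :
  measurable_fun setT g -> (forall s, 0 <= g s) ->
  \int[jump_kernel h]_s g s =
  if (last_step h).1 == +oo then g (+oo, None) else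
  \int[lebesgue_measure]_(u in `]0%R, +oo[) (expeR (- hazard h u) *
      \int[intensity (h, u)]_y g (u%:E, Some y))
  + expeR (- total_hazard h) * g (+oo, None).
Proof.
move=> mg g0; rewrite /jump_kernel (svalP jump_kernel_sig) /jump_kernel_def /kadd/= ge0_integral_measure_add//.
rewrite [in X in _ + X]integral_kwdirac//.
pose q : R.-sfker (H * R) ~> step_t := intensity \; (kwdirac jump_weight_ge0
  jump_weight_le1 measurable_jump_weight measurable_jump_target
    : R.-sfker _ ~> _).
have qE u : \int[q (h, u)]_s g s =
    (if absorbed h then 0 else expeR (- hazard h u)) *
    \int[intensity (h, u)]_y g (u%:E, Some y).
  rewrite integral_kcomp//.
  under eq_integral do rewrite integral_kwdirac//.
  rewrite /jump_weight /jump_target /= -/(absorbed h).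
  have mg' : measurable_fun setT (fun y : S => g (u%:E, Some y)).
    apply: measurableT_comp => //; apply: measurable_fun_pair => //.
    exact: measurable_Some.
  case: ifP => _; first by rewrite integral0_eq ?mul0e// => y _; rewrite mul0e.
  have [r /andP[r0 _] ->] := expeRN_real (hazard_ge0 h u).
  by rewrite ge0_integralZl_EFin.
rewrite (@integral_kcomp _ _ _ _ _ _ _ (kpos_lebesgue H R) q)//.
rewrite integral_kpos_lebesgue; last 2 first.
- apply: (measurableT_comp (f := fun z => \int[q z]_s g s)) => //.
  apply: measurable_fun_integral_kernel => //.
  by move=> U mU; exact: measurable_kernel.
- by move=> u; exact: integral_ge0.
under eq_integral do rewrite qE.
rewrite /stay_weight -/(absorbed h); case: ifP => _.
  by rewrite integral0_eq ?add0e ?mul1e// => u _; rewrite mul0e.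
by have [r _ ->] := expeRN_real (total_hazard_ge0 h).
Qed.

Lemma jump_lawE h C : measurable C -> jump_law M k h C = jump_kernel h C.
Proof.
move=> mC; have -> : jump_kernel h C = \int[jump_kernel h]_s (\1_C s)%:E.
  by rewrite integral_indic// setIT.
rewrite (@integral_jump_kernel h (fun s => (\1_C s)%:E)); last 2 first.
- by apply/measurable_EFinP; exact: measurable_indic.
- by move=> s; rewrite lee_fin.
have dE (s : step_t) : \d_s C = (\1_C s)%:E :> \bar R by rewrite diracE indicE.
rewrite /jump_law dE.
case: ((last_step h).1 == +oo); first reflexivity.
have mC' u : measurable [set y | C (u%:E, Some y)].
  have : measurable_fun setT (fun y : S => (u%:E, Some y) : step_t).
    by apply: measurable_fun_pair => //; exact: measurable_Some.
  by move=> /(_ measurableT C mC); rewrite setTI.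
have hE u : \int[lebesgue_measure]_(v in `]0%R, u]) jump_intensity M k h v setT =
    hazard h u.
  by apply: eq_integral => v _; exact: jump_intensityE.
have tE : \int[lebesgue_measure]_(v in `]0%R, +oo[) jump_intensity M k h v setT =
    total_hazard h.
  by apply: eq_integral => v _; exact: jump_intensityE.
rewrite tE; congr (_ + _); apply: eq_integral => u _.
rewrite hE jump_intensityE// muleC; congr (_ * _).
rewrite [RHS](_ : _ = \int[intensity (h, u)]_y (\1_[set y | C (u%:E, Some y)] y)%:E).
  by rewrite integral_indic// setIT.
by apply: eq_integral => y _; rewrite !indicE.
Qed.

End jump_kernel.

(** * One-step inequalities *)

Section one_step.
Context (R : realType) dS dA (S : measurableType dS) (A : measurableType dA).
Variable M : ctmdp R S A.
Hypothesis mS1 : forall x, measurable ([set x] : set S).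
Variable E : nat -> set S.
Hypotheses (mE : forall n, measurable (E n)) (sE : separating E).
Variable Sl : nat -> set S.
Hypotheses (mSl : forall l, measurable (Sl l)) (Sl_cover : \bigcup_l Sl l = setT).
Hypothesis rate_bounded :
  forall l, ereal_sup [set exit_rate M x | x in Sl l] < +oo.
Variable k : kernel_family R S A.
Variables (w : S -> R) (rho b : R).
Hypotheses (mw : measurable_fun setT w) (w_ge0 : forall x, (0 <= w x)%R).
Hypotheses (rho_gt0 : (0 < rho)%R) (b_ge0 : (0 <= b)%R).
Hypothesis drift : forall x a, adm M x a ->
  charge_integral (rate M x a) (fun y => (w y)%:E) <= (rho * w x + b)%:E.
Local Notation wt := (shifted_weight w rho b).
Local Notation step_t := (\bar R * option S)%type.
Local Notation intensity m :=
  (@intensity R dS dA S A M mS1 E mE sE Sl mSl Sl_cover rate_bounded k m).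
Local Notation jump_kernel m :=
  (@jump_kernel R dS dA S A M mS1 E mE sE Sl mSl Sl_cover rate_bounded k m).

Let wt_ge0 x : (0 <= wt x)%R.
Proof. exact: shifted_weight_ge0. Qed.

Let mwt : measurable_fun setT (fun y => (wt y)%:E).
Proof. by apply/measurable_EFinP; exact: measurable_shifted_weight. Qed.

Lemma option_jump_rate_drift x a :
  \int[option_jump_rate mS1 mE sE mSl Sl_cover rate_bounded (Some x, a)]_y (wt y)%:E <=
  (rho%:E + option_jump_rate mS1 mE sE mSl Sl_cover rate_bounded (Some x, a) setT)
    * (wt x)%:E.
Proof.
have z0 (mu : {measure set S -> \bar R}) : (forall G, measurable G -> mu G = 0) ->
    \int[mu]_y (wt y)%:E <= (rho%:E + mu setT) * (wt x)%:E.
  move=> mu0; rewrite (@eq_measure_integral _ _ _ _ mzero); last first.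
    by move=> G mG _; rewrite mu0.
  rewrite integral_measure_zero mu0// adde0 mule_ge0// lee_fin//.
  exact: ltW.
case: a => [a|] /=; last exact: z0.
have [xa|xa] := pselect (adm M x a).
  exact: jump_rate_shifted_drift.
by apply: z0 => G mG; rewrite /= /jump_rate; case: asboolP => // -[].
Qed.

Section history.
Variables (m : nat) (h : hist R S m) (x : S).
Hypothesis hx : (last_step h).2 = Some x.

(** The drift inequality is linear in the rate, hence survives the average over
    actions. *)
Lemma intensity_drift u :
  \int[intensity m (h, u)]_y (wt y)%:E <=
  (rho%:E + intensity m (h, u) setT) * (wt x)%:E.
Proof.
rewrite integral_kcomp//.
set q := kpullback _ _ : R.-sfker _ ~> _.
have qE a : q (h, u, a) =
    option_jump_rate mS1 mE sE mSl Sl_cover rate_bounded (Some x, a).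
  by rewrite -hx.
have mqT : measurable_fun setT (fun a : option A => q (h, u, a) setT).
  exact: (measurableT_comp (measurable_kernel q _ measurableT) (g := pair (h, u))).
apply: (@le_trans _ _ (\int[k m (h, u)]_a
    ((wt x)%:E * (rho%:E + q (h, u, a) setT)))).
  apply: ge0_le_integral => //.
  - by move=> a _; apply: integral_ge0 => y _; rewrite lee_fin.
  - apply: (measurableT_comp (f := fun z => \int[q z]_s (wt s)%:E)
      (g := pair (h, u))) => //.
    apply: measurable_fun_integral_kernel => //; exact: measurable_kernel.
  - by apply: emeasurable_funM => //; exact: emeasurable_funD.
  - by move=> a _; rewrite muleC qE; exact: option_jump_rate_drift.
rewrite ge0_integralZl_EFin//; last 2 first.
- by move=> a _; rewrite adde_ge0// lee_fin ltW.
- exact: emeasurable_funD.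
rewrite muleC lee_wpmul2r ?lee_fin//.
rewrite ge0_integralD//; last by move=> a _; rewrite lee_fin ltW.
by rewrite (integral_cst (k m (h, u)) measurableT) prob_kernel mule1.
Qed.

(** A bound [K] on the exit rate of the current state makes the hazard rate of
    the waiting time a bounded real function, as required by
    [integral_hazard]. *)
Lemma intensityT_real K : exit_rate M x <= K%:E ->
  exists lam : R -> R, [/\ measurable_fun setT lam, forall u, (0 <= lam u)%R,
    forall u, (lam u <= K)%R & forall u, intensity m (h, u) setT = (lam u)%:E].
Proof.
move=> xK; exists (fun u => fine (intensity m (h, u) setT)).
have le u : intensity m (h, u) setT <= K%:E.
  exact: le_trans (intensityT_le _ _ _ _ _ _ _ _ hx) xK.
have ge u : 0 <= intensity m (h, u) setT by exact: measure_ge0.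
have fin u : intensity m (h, u) setT \is a fin_num.
  by rewrite ge0_fin_numE// (le_lt_trans (le u)) ?ltry.
split => [|u|u|u].
- apply: measurableT_comp => //.
  apply: (measurableT_comp (measurable_kernel (intensity m) _ measurableT)
    (g := pair h)) => //.
- exact: fine_ge0.
- by rewrite -lee_fin fineK.
- by rewrite fineK.
Qed.

Lemma exit_rate_fin : exit_rate M x <= (fine (exit_rate M x))%:E.
Proof.
rewrite fineK// ge0_fin_numE; first exact: rate_stable.
have [f _ _] := adm_selector M.
exact: le_trans (measure_ge0 _ _) (jump_rateT_le M mS1 x (f x)).
Qed.

(** The common core of the one-step inequalities: [c] is the value before the
    jump, [f] bounds the relative gain rate of a jump at time [u], [e] bounds the
    relative value of never jumping, and the last hypothesis says that these add
    up to at most 1 under the law of the waiting time. *)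
Lemma jump_kernel_integral_le (lam f : R -> R) (c e : R) (g : step_t -> \bar R) :
  (last_step h).1 != +oo ->
  (forall u, intensity m (h, u) setT = (lam u)%:E) ->
  measurable_fun setT g -> (forall s, 0 <= g s) ->
  measurable_fun setT f -> (forall u, 0 <= f u)%R -> (0 <= c)%R -> (0 <= e)%R ->
  (forall u, (0 < u)%R ->
    \int[intensity m (h, u)]_y g (u%:E, Some y) <= (f u * c)%:E) ->
  g (+oo, None) <= (e * c)%:E ->
  \int[lebesgue_measure]_(u in `]0%R, +oo[)
     (expeR (- \int[lebesgue_measure]_(v in `]0%R, u]) (lam v)%:E) * (f u)%:E)
  + expeR (- \int[lebesgue_measure]_(v in `]0%R, +oo[) (lam v)%:E) * e%:E <= 1 ->
  \int[jump_kernel m h]_s g s <= c%:E.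
Proof.
move=> hfin lamE mg g0 mf f0 c0 e0 gf ge int1.
rewrite integral_jump_kernel// (negbTE hfin).
have hzE u : hazard mS1 mE sE mSl Sl_cover rate_bounded k h u =
    \int[lebesgue_measure]_(v in `]0%R, u]) (lam v)%:E.
  by apply: eq_integral => v _; rewrite lamE.
have thzE : total_hazard mS1 mE sE mSl Sl_cover rate_bounded k h =
    \int[lebesgue_measure]_(v in `]0%R, +oo[) (lam v)%:E.
  by apply: eq_integral => v _; rewrite lamE.
under eq_integral do rewrite hzE.
rewrite thzE; set S0 := expeR (- _).
set I := \int[_]_(u in _) _ in int1 *.
have mS : measurable_fun setT (fun u => expeR (- hazard mS1 mE sE mSl Sl_cover rate_bounded k h u)).
  apply: measurableT_comp; first exact: measurable_expeR.
  apply: measurableT_comp => //.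
  exact: (measurableT_comp (measurable_hazard mS1 mE sE mSl Sl_cover rate_bounded k (m := m))
    (g := pair h)).
have S00 : 0 <= S0 by exact: expeR_ge0.
apply: (@le_trans _ _ (c%:E * (I + S0 * e%:E))); last first.
  by rewrite -[leRHS]mule1 lee_wpmul2l// lee_fin.
rewrite ge0_muleDr; last 2 first.
- by apply: integral_ge0 => u _; rewrite mule_ge0 ?expeR_ge0 ?lee_fin.
- by rewrite mule_ge0 ?lee_fin.
apply: leeD.
  rewrite -ge0_integralZl_EFin//; last 2 first.
  - by move=> u _; rewrite mule_ge0 ?expeR_ge0 ?lee_fin.
  - apply: measurable_funTS; apply: emeasurable_funM; last exact/measurable_EFinP.
    by under eq_fun do rewrite -hzE.
  apply: le_integral_nonmeasurable => u; rewrite /= in_itv/= andbT => u0.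
    by rewrite mule_ge0 ?expeR_ge0// integral_ge0.
  by rewrite muleCA -EFinM mulrC lee_wpmul2l ?expeR_ge0// gf.
by rewrite muleCA -EFinM mulrC lee_wpmul2l// expeR_ge0.
Qed.

Let mweight : measurable_fun setT
  (fun s : step_t => discount_factor rho s.1 * (oapp wt 0%R s.2)%:E).
Proof.
apply: emeasurable_funM.
  by apply: measurableT_comp => //; exact: measurable_discount_factor.
exact: (measurableT_comp (f := fun o : option S => (oapp wt 0%R o)%:E)).
Qed.

Let mexp : measurable_fun setT (fun u : R => expR (- (rho * u))%R).
Proof. by apply: measurableT_comp => //; apply: measurableT_comp. Qed.

(** The supermartingale step: the gain rate of the discounted weight is at most
    [lam + rho] by the drift, and nothing is left when no jump occurs. *)
Lemma jump_kernel_discounted_weight_le : (last_step h).1 != +oo ->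
  \int[jump_kernel m h]_s (discount_factor rho s.1 * (oapp wt 0%R s.2)%:E) <=
  (wt x)%:E.
Proof.
move=> hfin.
have [lam [mlam lam0 lamK lamE]] := intensityT_real exit_rate_fin.
apply: (@jump_kernel_integral_le lam
  (fun u => (lam u + rho) * expR (- (rho * u)))%R _ 0%R) => //.
- move=> s; rewrite mule_ge0 ?expeR_ge0// lee_fin.
  by case: s.2 => [y|] //=.
- apply: measurable_funM => //; exact: measurable_funD.
- by move=> u; rewrite mulr_ge0 ?expR_ge0// addr_ge0// ltW.
- move=> u u0 /=; rewrite discount_factorE.
  rewrite ge0_integralZl_EFin ?expR_ge0//; last by move=> y _; rewrite lee_fin.
  rewrite [(_ * expR _)%R]mulrC -mulrA EFinM lee_wpmul2l ?lee_fin ?expR_ge0//.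
  by apply: le_trans (intensity_drift u) _; rewrite lamE -EFinD addrC -EFinM.
- by rewrite mule0 mul0r.
- rewrite mule0 adde0.
  exact: (integral_hazard_laplace_le1 mlam lam0 lamK (ltW rho_gt0)).
Qed.

(** A hazard rate [lam <= K] satisfies [lam <= K / (K + rho) * (lam + rho)], with
    equality for [lam = K]. *)
Lemma jump_kernel_discount_le K : (last_step h).1 != +oo -> exit_rate M x <= K%:E ->
  \int[jump_kernel m h]_s discount_factor rho s.1 <= (K / (K + rho))%:E.
Proof.
move=> hfin xK.
have K0 : (0 <= K)%R.
  have [f _ _] := adm_selector M; rewrite -lee_fin; apply: le_trans xK.
  exact: le_trans (measure_ge0 _ _) (jump_rateT_le M mS1 x (f x)).
have Krho : (0 < K + rho)%R by rewrite ltr_wpDl.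
have [lam [mlam lam0 lamK lamE]] := intensityT_real xK.
apply: (@jump_kernel_integral_le lam
  (fun u => (lam u + rho) * expR (- (rho * u)))%R _ 0%R) => //.
- apply: measurableT_comp => //; exact: measurable_discount_factor.
- by move=> s; exact: discount_factor_ge0.
- apply: measurable_funM => //; exact: measurable_funD.
- by move=> u; rewrite mulr_ge0 ?expR_ge0// addr_ge0// ltW.
- by rewrite divr_ge0// ltW.
- move=> u u0 /=; rewrite discount_factorE.
  rewrite integral_cst//= lamE -EFinM lee_fin mulrC mulrAC ler_wpM2r ?expR_ge0//.
  rewrite mulrA ler_pdivlMr//.
  by have := ler_wpM2r (ltW rho_gt0) (lamK u); rewrite !mulrDr !mulrDl; lra.
- by rewrite /= discount_factor_pinfty// mul0r.
- rewrite mule0 adde0.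
  exact: (integral_hazard_laplace_le1 mlam lam0 lamK (ltW rho_gt0)).
Qed.

Lemma jump_kernel_discount_le1 : (last_step h).1 != +oo ->
  \int[jump_kernel m h]_s discount_factor rho s.1 <= 1.
Proof.
move=> hfin; apply: le_trans (jump_kernel_discount_le hfin exit_rate_fin) _.
have K0 : (0 <= fine (exit_rate M x))%R.
  have [f _ _] := adm_selector M; apply: fine_ge0.
  exact: le_trans (measure_ge0 _ _) (jump_rateT_le M mS1 x (f x)).
by rewrite lee_fin ler_pdivrMr ?ltr_wpDl// mul1r lerDl ltW.
Qed.

(** Here [D] is the set of waiting times that end before the clock stops, which
    happens [r] units of time after the last jump. A jump at [r] itself may be
    counted either way. If the next jump comes too late, the current state is
    kept and discounted at time [r]. *)
Lemma jump_kernel_stopped_le (D : set (\bar R)) r :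
  (last_step h).1 != +oo -> (0 <= r)%R -> measurable D ->
  (forall u : R, D u%:E -> (u <= r)%R) -> (forall u : R, ~ D u%:E -> (r <= u)%R) ->
  ~ D +oo ->
  \int[jump_kernel m h]_s
    (if `[< D s.1 >] then discount_factor rho s.1 * (oapp wt 0%R s.2)%:E
     else (expR (- (rho * r)) * wt x)%:E) <=
  (wt x)%:E.
Proof.
move=> hfin r0 mD Dle Dge Doo.
have [lam [mlam lam0 lamK lamE]] := intensityT_real exit_rate_fin.
apply: (@jump_kernel_integral_le lam
  (fun u => if u <= r then (lam u + rho) * expR (- (rho * u))
            else lam u * expR (- (rho * r)))%R _ (expR (- (rho * r)))%R) => //.
- apply: measurable_fun_ifT => //.
  exact: (measurableT_comp (measurable_asbool mD) measurable_fst).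
- move=> s; case: ifP => _; last by rewrite lee_fin mulr_ge0 ?expR_ge0.
  rewrite mule_ge0 ?discount_factor_ge0// lee_fin.
  by case: s.2 => [y|] //=.
- apply: measurable_fun_ifT; first exact: measurable_fun_ler.
    apply: measurable_funM => //; exact: measurable_funD.
  exact: measurable_funM.
- move=> u; case: ifP => _; rewrite mulr_ge0 ?expR_ge0//.
  by rewrite addr_ge0// ltW.
- move=> u u0 /=; case: asboolP => Du; last first.
    rewrite integral_cst//= lamE -EFinM lee_fin.
    have ru := Dge _ Du; case: ifPn => [ur|_]; last by rewrite mulrC mulrA.
    have -> : u = r by apply/eqP; rewrite eq_le ur ru.
    rewrite mulrC mulrA ler_wpM2r// ler_wpM2r ?expR_ge0// lerDl.
    exact: ltW.
  rewrite (Dle _ Du) discount_factorE.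
  rewrite ge0_integralZl_EFin ?expR_ge0//; last by move=> y _; rewrite lee_fin.
  rewrite [(_ * expR _)%R]mulrC -mulrA EFinM lee_wpmul2l ?lee_fin ?expR_ge0//.
  by apply: le_trans (intensity_drift u) _; rewrite lamE -EFinD addrC -EFinM.
- by rewrite /=; case: asboolP.
- exact: (integral_hazard_stopped_le1 mlam lam0 lamK (ltW rho_gt0)).
Qed.

End history.
End one_step.

(** * Trajectories *)

Section coordinates.
Context (R : realType) d (S : measurableType d).

Lemma measurable_init : measurable_fun setT (@init R S).
Proof.
move=> _ B mB; rewrite setTI; apply: sub_sigma_algebra; left.
by exists B => //; rewrite setTI.
Qed.

Lemma measurable_step l : measurable_fun setT (fun omega : trajectory R S => step omega l).
Proof.
move=> _ B mB; rewrite setTI; apply: sub_sigma_algebra; right.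
by exists l => //; exists B => //; rewrite setTI.
Qed.

Lemma measurable_history m : measurable_fun setT (@history R d S m).
Proof.
apply: measurable_fun_pair; first exact: measurable_init.
apply/measurable_fun_tnthP => i.
rewrite (_ : _ \o _ = fun omega : trajectory R S => step omega i).
  exact: measurable_step.
by apply/funext => omega /=; rewrite tnth_mktuple.
Qed.

Lemma integral_init (P : probability (trajectory R S) R) (gamma : probability S R)
    (f : S -> \bar R) : measurable_fun setT f ->
  (forall x, 0 <= f x) ->
  (forall G : set S, measurable G -> P (@init R S @^-1` G) = gamma G) ->
  \int[P]_omega f (init omega) = \int[gamma]_x f x.
Proof.
move=> mf f0 Pinit.
transitivity (\int[measure_function_pushforward__canonical__measure_function_Measure
    P measurable_init]_x f x).
  rewrite ge0_integral_pushforward//; exact: measurable_init.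
apply: eq_measure_integral => G mG _.
by rewrite /=/pushforward Pinit.
Qed.

End coordinates.

Section trajectory_facts.
Context (R : realType) d (S : measurableType d).
Implicit Types omega : trajectory R S.

Lemma step_gt0 omega l : 0 < (step omega l).1.
Proof.
case: (step_valid omega) => [/(_ l)[/andP[]]//|[n [lt ge]]].
by have [ln|nl] := ltnP l n; [have [/andP[]] := lt _ ln|rewrite ge//; exact: ltry].
Qed.

Lemma jump_time0 omega : jump_time omega 0 = 0.
Proof. by rewrite /jump_time big_ord0. Qed.

Lemma jump_timeS omega m :
  jump_time omega m.+1 = jump_time omega m + (step omega m).1.
Proof. by rewrite /jump_time big_ord_recr. Qed.

Lemma jump_time_ge0 omega m : 0 <= jump_time omega m.
Proof. by apply: sume_ge0 => l _; exact/ltW/step_gt0. Qed.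

Lemma jump_time_nd omega m n : (m <= n)%N -> jump_time omega m <= jump_time omega n.
Proof.
elim: n => [|n IH]; first by rewrite leqn0 => /eqP->.
rewrite leq_eqVlt => /predU1P[->//|/IH /le_trans->//].
by rewrite jump_timeS leeDl// ltW// step_gt0.
Qed.

Lemma last_step0 (h : hist R S 0) : last_step h = (0, Some h.1).
Proof. by case: h => x t; rewrite /last_step (tuple0 t). Qed.

Lemma last_step_history m omega : (last_step (history m omega)).2 = state omega m.
Proof.
case: m => [|m]; first by rewrite last_step0.
by rewrite last_step_tnth /= tnth_mktuple.
Qed.

Lemma last_step_history1 m omega :
  (last_step (history m omega)).1 = if m is l.+1 then (step omega l).1 else 0.
Proof.
case: m => [|m]; first by rewrite last_step0.
by rewrite last_step_tnth /= tnth_mktuple.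
Qed.

(** A trajectory is alive after [m] jumps or it has been absorbed before. This
    dichotomy reduces the estimates below to histories with a finite last sojourn
    time and a genuine last state. *)
Lemma trajectory_cases m omega :
  (exists (t : R) (x : S), [/\ (0 <= t)%R, jump_time omega m = t%:E,
      state omega m = Some x & (last_step (history m omega)).1 != +oo]) \/
  [/\ jump_time omega m = +oo, state omega m = None &
      (last_step (history m omega)).1 = +oo].
Proof.
have alive n : (forall l, (l < n)%N -> jump_step (step omega l)) ->
    exists (t : R) (x : S), [/\ (0 <= t)%R, jump_time omega n = t%:E,
      state omega n = Some x & (last_step (history n omega)).1 != +oo].
  move=> Hn; have tfin : jump_time omega n \is a fin_num.
    rewrite ge0_fin_numE ?jump_time_ge0//; apply: lte_sum_pinfty => l _.
    by have [/andP[]] := Hn l (ltn_ord l).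
  exists (fine (jump_time omega n)); rewrite fineK//.
  rewrite last_step_history1; case: n Hn tfin => [|n] Hn tfin.
    by exists (init omega); split => //; rewrite fine_ge0// jump_time_ge0.
  have [/andP[_ lty]] := Hn n (ltnSn n).
  case sE : (step omega n).2 => [x|]// _; exists x; split => //.
    by rewrite fine_ge0// jump_time_ge0.
  by rewrite lt_eqF.
case: (step_valid omega) => [jumps|[n [lt ge]]].
  by left; apply: alive => l _; exact: jumps.
have [mn|] := leqP m n.
  by left; apply: alive => l lm; apply: lt; exact: leq_trans lm mn.
case: m => // m nm; right; rewrite last_step_history1 jump_timeS /= ge//=.
by split => //; rewrite addey// gt_eqF// (lt_le_trans _ (jump_time_ge0 _ _)).
Qed.

Definition hist_time m (h : hist R S m) : \bar R := \sum_(l < m) (tnth h.2 l).1.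

Lemma hist_time_history m omega : hist_time (history m omega) = jump_time omega m.
Proof. by apply: eq_bigr => l _; rewrite tnth_mktuple. Qed.

Lemma measurable_hist_time m : measurable_fun setT (@hist_time m).
Proof.
apply: emeasurable_sum => l; apply: measurableT_comp => //.
exact: measurableT_comp (measurable_tnth _) measurable_snd.
Qed.

Lemma measurable_jump_time m : measurable_fun setT (@jump_time R d S ^~ m).
Proof.
rewrite (_ : _ ^~ _ = @hist_time m \o history m).
  exact: measurableT_comp (@measurable_hist_time m) (@measurable_history _ _ _ m).
by apply/funext => omega /=; rewrite hist_time_history.
Qed.

Lemma measurable_state m : measurable_fun setT (@state R d S ^~ m).
Proof.
rewrite (_ : _ ^~ _ = fun omega => (last_step (history m omega)).2).
  apply: measurableT_comp => //.
  exact: measurableT_comp (@measurable_last_step _ _ _ m) (@measurable_history _ _ _ m).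
by apply/funext => omega; rewrite last_step_history.
Qed.

(** The jump times increase to the explosion time. *)
Lemma explosion_timeP omega :
  explosion_time omega <> +oo <-> exists t : nat, forall m, jump_time omega m <= t%:R%:E.
Proof.
have supT : explosion_time omega = ereal_sup (range (jump_time omega)).
  apply/cvg_lim => //; apply: ereal_nondecreasing_cvgn => m n.
  exact: jump_time_nd.
have ubT m : jump_time omega m <= explosion_time omega.
  by rewrite supT; apply: ereal_sup_ubound; exists m.
split=> [|[t Tt]]; last first.
  suff : explosion_time omega <= t%:R%:E by move=> + E; rewrite E leye_eq.
  by rewrite supT; apply: ge_ereal_sup => _ [m _ <-]; exact: Tt.
case TE : (explosion_time omega) => [t| |]// _; last first.
  by have := ubT 0%N; rewrite TE jump_time0.
have t0 : (0 <= t)%R.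
  by rewrite -lee_fin; have := ubT 0%N; rewrite TE jump_time0.
exists (Num.bound t) => m; apply: le_trans (ubT m) _.
by rewrite TE lee_fin ltW// archi_boundP.
Qed.

Lemma measurable_explosion :
  measurable [set omega : trajectory R S | explosion_time omega = +oo].
Proof.
rewrite (_ : [set omega | _] = ~` \bigcup_(t : nat) \bigcap_m
    [set omega : trajectory R S | jump_time omega m <= t%:R%:E]); last first.
  apply/seteqP; split => omega /=.
    move=> Too [t _ Tt]; have : explosion_time omega <> +oo; last by [].
    by apply/explosion_timeP; exists t => m; exact: Tt.
  move=> H; apply: contrapT => /explosion_timeP[t Tt]; apply: H.
  by exists t => // m _; exact: Tt.
apply: measurableC; apply: bigcupT_measurable => t; apply: bigcapT_measurable => m.
rewrite -[X in measurable X]setTI; apply: measurable_lee => //.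
exact: measurable_jump_time.
Qed.

End trajectory_facts.

(** * Integration of a function of the history and the next step *)

Section step_expectation.
Context (R : realType) dS dA (S : measurableType dS) (A : measurableType dA).
Variable M : ctmdp R S A.
Hypothesis mS1 : forall x, measurable ([set x] : set S).
Variable E : nat -> set S.
Hypotheses (mE : forall n, measurable (E n)) (sE : separating E).
Variable Sl : nat -> set S.
Hypotheses (mSl : forall l, measurable (Sl l)) (Sl_cover : \bigcup_l Sl l = setT).
Hypothesis rate_bounded :
  forall l, ereal_sup [set exit_rate M x | x in Sl l] < +oo.
Variable k : kernel_family R S A.
Variable P : probability (trajectory R S) R.
Local Notation step_t := (\bar R * option S)%type.
Local Notation jump_kernel m :=
  (@jump_kernel R dS dA S A M mS1 E mE sE Sl mSl Sl_cover rate_bounded k m).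
Variable m : nat.
Hypothesis P_jump : forall (B : set (hist R S m)) (C : set step_t),
  measurable B -> measurable C ->
  P ((history m @^-1` B) `&` [set omega | C (step omega m)]) =
  \int[P]_(omega in history m @^-1` B) jump_law M k (history m omega) C.
Local Notation H := (hist R S m).

Let history_step (omega : trajectory R S) : H * step_t :=
  (history m omega, step omega m).

Let measurable_history_step : measurable_fun setT history_step.
Proof.
apply: measurable_fun_pair; first exact: measurable_history.
exact: measurable_step.
Qed.

Let law1 : {measure set (H * step_t) -> \bar R} :=
  measure_function_pushforward__canonical__measure_function_Measure
    P measurable_history_step.

Let joint : R.-sfker H ~> (H * step_t)%type :=
  jump_kernel m \; (kdirac (@measurable_id _ _ setT) : R.-sfker _ ~> _).

Let const_P : R.-sfker unit ~> trajectory R S :=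
  kprobability (@measurable_cst _ _ _ _ setT (P : pprobability _ _)).

Let measurable_history_snd :
  measurable_fun setT (fun z : unit * trajectory R S => history m z.2).
Proof. by apply: measurableT_comp; first exact: measurable_history. Qed.

Let law2 : {measure set (H * step_t) -> \bar R} :=
  (const_P \; (kpullback measurable_history_snd joint : R.-sfker _ ~> _)) tt.

Let integral_joint h (g : H * step_t -> \bar R) :
  measurable_fun setT g -> (forall z, 0 <= g z) ->
  \int[joint h]_z g z = \int[jump_kernel m h]_s g (h, s).
Proof.
move=> mg g0; rewrite integral_kcomp//; apply: eq_integral => s _.
by rewrite /= integral_dirac// diracT mul1e.
Qed.

Let joint_rectangle h B C : measurable B -> measurable C ->
  joint h (B `*` C) = (\1_B h)%:E * jump_kernel m h C.
Proof.
move=> mB mC; rewrite [LHS](_ : _ = \int[joint h]_z (\1_(B `*` C) z)%:E); last first.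
  by rewrite integral_indic ?setIT//; exact: measurableX.
rewrite integral_joint; last 2 first.
- by apply/measurable_EFinP; apply: measurable_indic; exact: measurableX.
- by move=> z; rewrite lee_fin.
have rectE s : (\1_(B `*` C) (h, s))%:E = (\1_B h)%:E * (\1_C s)%:E :> \bar R.
  by rewrite !indicE in_setX -EFinM -natrM mulnb.
under eq_integral do rewrite rectE.
rewrite ge0_integralZl_EFin//; first by rewrite integral_indic// setIT.
by apply/measurable_EFinP; exact: measurable_indic.
Qed.

Let law12 Z : measurable Z -> law1 Z = law2 Z.
Proof.
pose G : set (set (H * step_t)) :=
  [set B `*` C | B in @measurable _ H & C in @measurable _ step_t].
apply: (measure_unique G (fun=> setT)).
- exact: measurable_prod_measurableType.
- move=> _ _ [B1 mB1 [C1 mC1 <-]] [B2 mB2 [C2 mC2 <-]].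
  exists (B1 `&` B2); first exact: measurableI.
  by exists (C1 `&` C2); [exact: measurableI|rewrite setXI].
- by move=> _; exists setT => //; exists setT => //; rewrite setXTT.
- by rewrite bigcup_const.
- move=> _ [B mB [C mC <-]].
  transitivity (P ((history m @^-1` B) `&` [set omega | C (step omega m)])).
    by congr (P _); apply/seteqP; split => omega [].
  rewrite P_jump// integral_mkcond.
  transitivity (\int[P]_omega joint (history m omega) (B `*` C)); last by [].
  apply: eq_integral => omega _; rewrite joint_rectangle// patchE indicE.
  rewrite (_ : (omega \in _) = (history m omega \in B)); last first.
    by apply/idP/idP; rewrite !inE.
  case: ifPn => _; rewrite ?mul1e ?mul0e//.
  exact: jump_lawE.
- move=> _; rewrite /law1 /= /pushforward preimage_setT.
  by rewrite (@le_lt_trans _ _ 1) ?ltry// probability_le1.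
Qed.

(** The defining property of the process determines the joint law of the history
    and the next step on rectangles, hence everywhere. *)
Lemma step_expectation (g : H * step_t -> \bar R) :
  measurable_fun setT g -> (forall z, 0 <= g z) ->
  \int[P]_omega g (history m omega, step omega m) =
  \int[P]_omega \int[jump_kernel m (history m omega)]_s g (history m omega, s).
Proof.
move=> mg g0.
transitivity (\int[law1]_z g z).
  by rewrite /law1 ge0_integral_pushforward.
transitivity (\int[law2]_z g z).
  by apply: eq_measure_integral => Z mZ _; exact: law12.
rewrite integral_kcomp//; apply: eq_integral => omega _.
exact: integral_joint.
Qed.

End step_expectation.

(** * Discounted weight and discounted mass along the jumps *)

Section supermartingale.
Context (R : realType) dS dA (S : measurableType dS) (A : measurableType dA).
Variable M : ctmdp R S A.
Hypothesis mS1 : forall x, measurable ([set x] : set S).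
Variable E : nat -> set S.
Hypotheses (mE : forall n, measurable (E n)) (sE : separating E).
Variable Sl : nat -> set S.
Hypotheses (mSl : forall l, measurable (Sl l)) (Sl_cover : \bigcup_l Sl l = setT).
Hypothesis rate_bounded :
  forall l, ereal_sup [set exit_rate M x | x in Sl l] < +oo.
Variable k : kernel_family R S A.
Variables (w : S -> R) (rho b : R).
Hypotheses (mw : measurable_fun setT w) (w_ge0 : forall x, (0 <= w x)%R).
Hypotheses (rho_gt0 : (0 < rho)%R) (b_ge0 : (0 <= b)%R).
Hypothesis drift : forall x a, adm M x a ->
  charge_integral (rate M x a) (fun y => (w y)%:E) <= (rho * w x + b)%:E.
Variable P : probability (trajectory R S) R.
Local Notation step_t := (\bar R * option S)%type.
Hypothesis P_jump : forall m (B : set (hist R S m)) (C : set step_t),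
  measurable B -> measurable C ->
  P ((history m @^-1` B) `&` [set omega | C (step omega m)]) =
  \int[P]_(omega in history m @^-1` B) jump_law M k (history m omega) C.
Local Notation wt := (shifted_weight w rho b).
Local Notation disc := (discount_factor rho).
Local Notation jump_kernel m :=
  (@jump_kernel R dS dA S A M mS1 E mE sE Sl mSl Sl_cover rate_bounded k m).

Let wt_ge0 x : (0 <= wt x)%R.
Proof. exact: shifted_weight_ge0. Qed.

Let owt (o : option S) : \bar R := (oapp wt 0%R o)%:E.

Let owt_ge0 o : 0 <= owt o.
Proof. by rewrite lee_fin; case: o. Qed.

Let measurable_owt : measurable_fun setT owt.
Proof.
apply: measurable_fun_option.
by apply/measurable_EFinP; exact: measurable_shifted_weight.
Qed.

(** This is how a one-step inequality is used: it is enough to bound the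
    conditional expectation of [g] along each trajectory. *)
Lemma expectation_step_le m (g : hist R S m * step_t -> \bar R)
    (V : trajectory R S -> \bar R) :
  measurable_fun setT g -> (forall z, 0 <= g z) ->
  (forall omega, \int[jump_kernel m (history m omega)]_s g (history m omega, s)
      <= V omega) ->
  \int[P]_omega g (history m omega, step omega m) <= \int[P]_omega V omega.
Proof.
move=> mg g0 gV.
rewrite (step_expectation mS1 mE sE mSl Sl_cover rate_bounded (@P_jump m))//.
apply: le_integral_nonmeasurable => omega _; last exact: gV.
by apply: integral_ge0 => s _.
Qed.

Let mdisc : measurable_fun setT disc.
Proof. exact: measurable_discount_factor. Qed.

Let disc_ge0 t : 0 <= disc t.
Proof. exact: discount_factor_ge0. Qed.

Let mstepw : measurable_fun setT (fun s : step_t => disc s.1 * owt s.2).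
Proof.
by apply: emeasurable_funM; apply: measurableT_comp.
Qed.

Let stepw_ge0 (s : step_t) : 0 <= disc s.1 * owt s.2.
Proof. exact: mule_ge0. Qed.

Let mstepd : measurable_fun setT (fun s : step_t => disc s.1).
Proof. exact: measurableT_comp. Qed.

Let mdiscT m : measurable_fun setT (fun omega : trajectory R S => disc (jump_time omega m)).
Proof. exact: measurableT_comp mdisc (@measurable_jump_time _ _ _ m). Qed.

Section initial_set.
Variable G : set S.
Hypothesis mG : measurable G.

Let eG (omega : trajectory R S) : \bar R := (\1_G (init omega))%:E.

Let meG : measurable_fun setT eG.
Proof.
apply/measurable_EFinP; apply: measurableT_comp; last exact: measurable_init.
exact: measurable_indic.
Qed.

Let mhistG m : measurable_fun setT
  (fun z : hist R S m * step_t => (\1_G z.1.1)%:E * disc (hist_time z.1)).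
Proof.
apply: emeasurable_funM.
  apply/measurable_EFinP; apply: (measurableT_comp (measurable_indic mG)).
  exact: measurableT_comp.
apply: measurableT_comp => //; apply: measurableT_comp => //.
exact: measurable_hist_time.
Qed.

(** Restricting to the trajectories that start in [G] makes the expectation finite
    for any initial distribution as soon as [w] is bounded on [G]. *)
Definition discounted_weight m omega : \bar R :=
  eG omega * disc (jump_time omega m) * owt (state omega m).

Definition discounted m omega : \bar R := eG omega * disc (jump_time omega m).

Lemma discounted_weight_supermartingale m :
  \int[P]_omega discounted_weight m.+1 omega <= \int[P]_omega discounted_weight m omega.
Proof.
pose g (z : hist R S m * step_t) : \bar R :=
  (\1_G z.1.1)%:E * disc (hist_time z.1) * (disc z.2.1 * owt z.2.2).
rewrite (_ : \int[P]_omega _ = \int[P]_omega g (history m omega, step omega m)); last first.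
  apply: eq_integral => omega _.
  rewrite /discounted_weight /g /= hist_time_history jump_timeS.
  rewrite discount_factorD ?jump_time_ge0//; last exact/ltW/step_gt0.
  by rewrite -!muleA.
apply: expectation_step_le.
- by apply: emeasurable_funM; [exact: mhistG|exact: (measurableT_comp mstepw measurable_snd)].
- by move=> z; rewrite /g !mule_ge0// lee_fin.
- move=> omega; rewrite /g /=.
  rewrite /discounted_weight hist_time_history.
  case: (trajectory_cases m omega) => [[t [x [t0 -> sx hfin]]]|[-> -> hoo]].
    rewrite sx /eG discount_factorE -EFinM.
    rewrite ge0_integralZl_EFin//.
    rewrite lee_wpmul2l//.
    apply: jump_kernel_discounted_weight_le => //.
    by rewrite last_step_history.
  rewrite discount_factor_pinfty// mule0 mul0e integral0_eq// => s _.
  by rewrite mul0e.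
Qed.

Lemma discounted_weight_le m :
  \int[P]_omega discounted_weight m omega <=
  \int[P]_omega (eG omega * (wt (init omega))%:E).
Proof.
elim: m => [|m]; last exact/le_trans/discounted_weight_supermartingale.
rewrite le_eqVlt; apply/orP; left; apply/eqP; apply: eq_integral => omega _.
rewrite /discounted_weight jump_time0 /discount_factor mule0 oppe0 expeR0.
by rewrite mule1.
Qed.

(** Integrate the one-step bound [K / (K + rho) = 1 - rho / (K + rho)] for states in
    [Sl l], and the trivial bound 1 for all other states. *)
Lemma discounted_contraction l K m : (forall x, Sl l x -> exit_rate M x <= K%:E) ->
  (0 <= K)%R ->
  \int[P]_omega discounted m.+1 omega +
  (rho / (K + rho))%:E * \int[P]_omega
     (discounted m omega * (\1_(Some @` Sl l) (state omega m))%:E) <=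
  \int[P]_omega discounted m omega.
Proof.
move=> SlK K0.
have Krho : (0 < K + rho)%R by rewrite ltr_wpDl.
have mSome : measurable (Some @` Sl l).
  rewrite /measurable/= (_ : Some @^-1` _ = Sl l)//.
  by apply/seteqP; split => x /=; [move=> [y ? [<-]]|exists x].
pose g (z : hist R S m * step_t) : \bar R :=
  (\1_G z.1.1)%:E * disc (hist_time z.1) * disc z.2.1.
pose V omega : \bar R := discounted m omega *
  (1 - rho / (K + rho) * \1_(Some @` Sl l) (state omega m))%:E.
have disc_meas : measurable_fun setT (discounted m) by exact: emeasurable_funM.
have ind_meas : measurable_fun setT
    (fun omega : trajectory R S => \1_(Some @` Sl l) (state omega m) : R).
  exact: measurableT_comp (measurable_indic mSome) (@measurable_state _ _ _ m).
have d0 omega : 0 <= discounted m omega by rewrite mule_ge0// lee_fin.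
have q1 : (0 <= rho / (K + rho) <= 1)%R.
  apply/andP; split; first by rewrite divr_ge0// ltW.
  by rewrite ler_pdivrMr// mul1r lerDr.
have V1 omega : (0 <= 1 - rho / (K + rho) * \1_(Some @` Sl l) (state omega m))%R.
  case/andP: q1 => q0 q1; rewrite subr_ge0 indicE.
  by case: (_ \in _); rewrite ?mulr1// mulr0.
have stepV : \int[P]_omega discounted m.+1 omega <= \int[P]_omega V omega.
  rewrite (_ : \int[P]_omega _ = \int[P]_omega g (history m omega, step omega m)); last first.
    apply: eq_integral => omega _.
    rewrite /discounted /g /= hist_time_history jump_timeS.
    rewrite discount_factorD ?jump_time_ge0//; last exact/ltW/step_gt0.
    by rewrite -!muleA.
  apply: expectation_step_le.
  - by apply: emeasurable_funM; [exact: mhistG|exact: (measurableT_comp mstepd measurable_snd)].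
  - by move=> z; rewrite /g !mule_ge0// lee_fin.
  - move=> omega; rewrite /g /= /V /discounted hist_time_history.
    case: (trajectory_cases m omega) => [[t [x [t0 -> sx hfin]]]|[-> -> hoo]].
      rewrite sx /eG discount_factorE -EFinM.
      rewrite ge0_integralZl_EFin//.
      rewrite lee_wpmul2l//.
      have hx : (last_step (history m omega)).2 = Some x by rewrite last_step_history.
      rewrite indicE; have [|_] := boolP (Some x \in Some @` Sl l); last first.
        by rewrite mulr0 subr0; apply: (jump_kernel_discount_le1 _ _ _ _ _ _ _ _ hx).
      rewrite inE => -[y Sy [yx]]; rewrite {}yx in Sy.
      have -> : (1 - rho / (K + rho) * 1%:R = K / (K + rho))%R.
        by field; rewrite gt_eqF.
      by apply: (jump_kernel_discount_le _ _ _ _ _ _ _ _ hx) => //; exact: SlK.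
    rewrite discount_factor_pinfty// mule0 mul0e integral0_eq// => s _.
    by rewrite mul0e.
rewrite -ge0_integralZl_EFin//; last 3 first.
- by move=> omega _; rewrite mule_ge0// lee_fin.
- by apply: emeasurable_funM => //; exact/measurable_EFinP.
- by case/andP: q1.
apply: le_trans (leeD2r _ stepV) _.
rewrite -ge0_integralD//; last 4 first.
- by move=> omega _; rewrite mule_ge0// lee_fin.
- apply: emeasurable_funM => //; apply/measurable_EFinP.
  by apply: measurable_funB => //; exact: measurable_funM.
- by move=> omega _; rewrite !mule_ge0// lee_fin; case/andP: q1.
- apply: emeasurable_funM => //; apply: emeasurable_funM => //.
  exact/measurable_EFinP.
rewrite le_eqVlt; apply/orP; left; apply/eqP; apply: eq_integral => omega _.
rewrite /V muleCA -ge0_muleDr ?lee_fin//; last first.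
  by case/andP: q1 => q0 _; rewrite mulr_ge0.
by rewrite -EFinM -EFinD subrK mule1.
Qed.

End initial_set.
End supermartingale.

(** * Non-explosion *)

(** The losses [d * s m] telescope, so that the [s m] have sum at most [d^-1]; as
    [e] decreases, [n * e n] is at most the sum of the first [n] terms of
    [s + c]. *)
Lemma contraction_rate (R : realType) (e s : nat -> R) (d c : R) : (0 < d)%R ->
  (forall m, 0 <= e m)%R -> (forall m, 0 <= s m)%R -> (e 0%N <= 1)%R ->
  (forall m, e m.+1 + d * s m <= e m)%R -> (forall m, e m <= s m + c)%R ->
  forall n, (n%:R * e n <= d^-1 + n%:R * c)%R.
Proof.
move=> d0 e0 s0 e1 es ec n.
have sum_s : (d * \sum_(i < n) s i <= 1 - e n)%R.
  elim: n => [|n IH]; first by rewrite big_ord0 mulr0 subr_ge0.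
  by rewrite big_ord_recr/= mulrDr; have := es n; lra.
have : (n%:R * e n <= \sum_(i < n) s i + n%:R * c)%R.
  elim: n {sum_s} => [|n IH]; first by rewrite big_ord0 !mul0r addr0.
  rewrite big_ord_recr/= -natr1 !mulrDl !mul1r.
  have en : (e n.+1 <= e n)%R.
    by apply: le_trans (es n); rewrite lerDl mulr_ge0// ltW.
  have := ler_wpM2l (ler0n R n) en; have := ec n; lra.
have : (\sum_(i < n) s i <= d^-1)%R.
  rewrite -(ler_pM2l d0) mulfV ?gt_eqF//; apply: le_trans sum_s _.
  by rewrite gerBl.
lra.
Qed.

Section nonexplosion.
Context (R : realType) dS dA (S : measurableType dS) (A : measurableType dA).
Variable M : ctmdp R S A.
Hypothesis mS1 : forall x, measurable ([set x] : set S).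
Variable E : nat -> set S.
Hypotheses (mE : forall n, measurable (E n)) (sE : separating E).
Variable Sl : nat -> set S.
Hypotheses (mSl : forall l, measurable (Sl l)) (Sl_cover : \bigcup_l Sl l = setT).
Hypothesis rate_bounded :
  forall l, ereal_sup [set exit_rate M x | x in Sl l] < +oo.
Variable k : kernel_family R S A.
Variables (w : S -> R) (rho b : R).
Hypotheses (mw : measurable_fun setT w) (w_ge0 : forall x, (0 <= w x)%R).
Hypotheses (rho_gt0 : (0 < rho)%R) (b_ge0 : (0 <= b)%R).
Hypothesis drift : forall x a, adm M x a ->
  charge_integral (rate M x a) (fun y => (w y)%:E) <= (rho * w x + b)%:E.
Variable P : probability (trajectory R S) R.
Local Notation step_t := (\bar R * option S)%type.
Hypothesis P_jump : forall m (B : set (hist R S m)) (C : set step_t),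
  measurable B -> measurable C ->
  P ((history m @^-1` B) `&` [set omega | C (step omega m)]) =
  \int[P]_(omega in history m @^-1` B) jump_law M k (history m omega) C.
Local Notation wt := (shifted_weight w rho b).
Local Notation disc := (discount_factor rho).
Local Notation jump_kernel m :=
  (@jump_kernel R dS dA S A M mS1 E mE sE Sl mSl Sl_cover rate_bounded k m).

Let wt_ge0 x : (0 <= wt x)%R.
Proof. exact: shifted_weight_ge0. Qed.

Hypothesis w_unbounded :
  (fun l => ereal_inf [set (w x)%:E | x in ~` Sl l]) @ \oo --> +oo.

Let large_weight (c : R) : exists l, forall x, ~ Sl l x -> (c <= w x)%R.
Proof.
have [l _ Hl] := cvgey_ge w_unbounded c.
exists l => x nSx; have := Hl l (leqnn l) => /= cl.
rewrite -lee_fin; apply: le_trans cl _; apply: ereal_inf_lbound.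
by exists x.
Qed.

Section level.
Variable N : nat.

Let G : set S := [set x | (w x <= N%:R)%R].

Let mG : measurable G.
Proof.
have : measurable_fun setT (fun x => w x <= N%:R)%R by exact: measurable_fun_ler.
by move=> /(_ measurableT [set true] I); rewrite setTI.
Qed.

Let e m := \int[P]_omega discounted rho G m omega.

Let disc_le1 (t : \bar R) : 0 <= t -> disc t <= 1.
Proof.
move=> t0; have : 0 <= rho%:E * t by rewrite mule_ge0// lee_fin ltW.
by move=> /expeRN_real[r /andP[_ r1]]; rewrite /discount_factor => ->.
Qed.

Let discounted_ge0 m omega : 0 <= discounted rho G m omega.
Proof. by rewrite mule_ge0 ?discount_factor_ge0// lee_fin. Qed.

Let discounted_le1 m omega : discounted rho G m omega <= 1.
Proof.
rewrite /discounted -[leRHS]mule1; apply: lee_pmul.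
- by rewrite lee_fin.
- exact: discount_factor_ge0.
- by rewrite lee_fin indicE; case: (_ \in _).
- exact/disc_le1/jump_time_ge0.
Qed.

Let mdiscounted m : measurable_fun setT (discounted rho G m).
Proof.
apply: emeasurable_funM.
  apply/measurable_EFinP; apply: (measurableT_comp (measurable_indic mG)).
  exact: measurable_init.
exact: measurableT_comp (@measurable_discount_factor _ rho) (@measurable_jump_time _ _ _ m).
Qed.

Let weight_ge0 m omega : 0 <= discounted_weight w rho b G m omega.
Proof.
rewrite mule_ge0// ?discounted_ge0// lee_fin.
by case: (state omega m).
Qed.

Let mweight m : measurable_fun setT (discounted_weight w rho b G m).
Proof.
apply: emeasurable_funM; first exact: mdiscounted.
apply: (measurableT_comp (f := fun o : option S => (oapp wt 0%R o)%:E)).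
  apply: measurable_fun_option.
  by apply/measurable_EFinP; exact: measurable_shifted_weight.
exact: measurable_state.
Qed.

Let integral_le1 (f : trajectory R S -> \bar R) : (forall omega, 0 <= f omega) ->
  (forall omega, f omega <= 1) -> 0 <= \int[P]_omega f omega <= 1.
Proof.
move=> f0 f1; rewrite integral_ge0//=.
apply: (@le_trans _ _ (\int[P]_omega cst 1 omega)).
  by apply: le_integral_nonmeasurable => omega _.
by rewrite integral_cst_prob.
Qed.

(** The part of [e m] outside of a large [Sl l] is small, uniformly in [m], since
    the weight is large there while the expected discounted weight stays below
    [N + b / rho]; the part inside is summable by contraction. *)
Lemma discounted_small (eps : R) : (0 < eps)%R -> exists n, e n <= eps%:E.
Proof.
move=> eps0; pose W := (N%:R + b / rho)%R.
have W0 : (0 <= W)%R by rewrite addr_ge0// divr_ge0// ltW.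
(* If the weight is at least [kappa] outside of [Sl l], the outer part of [e m]
   is at most [W / kappa], which is below [eps / 2]. *)
pose kappa := (2 * (W + 1) / eps)%R.
have kappa0 : (0 < kappa)%R by rewrite divr_gt0// mulr_gt0// ltr_wpDl.
have [l Sl_kappa] := large_weight kappa.
pose sl m := \int[P]_omega
  (discounted rho G m omega * (\1_(Some @` Sl l) (state omega m))%:E).
have mSome : measurable (Some @` Sl l).
  rewrite /measurable/= (_ : Some @^-1` _ = Sl l)//.
  by apply/seteqP; split => x /=; [move=> [y ? [<-]]|exists x].
have mstate m : measurable_fun setT
    (fun omega : trajectory R S => (\1_(Some @` Sl l) (state omega m))%:E).
  apply/measurable_EFinP.
  exact: measurableT_comp (measurable_indic mSome) (@measurable_state _ _ _ m).
have [K K0 SlK] : exists2 K : R, (0 <= K)%R & forall x, Sl l x -> exit_rate M x <= K%:E.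
  have := rate_bounded l; set B := ereal_sup _ => Boo.
  have ubB x : Sl l x -> exit_rate M x <= B.
    by move=> lx; apply: ereal_sup_ubound; exists x.
  exists (fine (maxe B 0)); first by rewrite fine_ge0// le_max lexx orbT.
  move=> x /ubB xB; rewrite fineK ?le_max ?xB//.
  by rewrite ge0_fin_numE ?le_max ?lexx ?orbT// gt_max Boo ltry.
have Krho : (0 < K + rho)%R by rewrite ltr_wpDl.
have es m : e m.+1 + (rho / (K + rho))%:E * sl m <= e m.
  exact: (discounted_contraction mS1 mE sE mSl Sl_cover rate_bounded rho_gt0 P_jump).
have weightW m : \int[P]_omega discounted_weight w rho b G m omega <= W%:E.
  apply: le_trans (discounted_weight_le mS1 mE sE mSl Sl_cover rate_bounded mw
    w_ge0 rho_gt0 b_ge0 drift P_jump mG m) _.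
  apply: (@le_trans _ _ (\int[P]_omega cst W%:E omega)).
    apply: le_integral_nonmeasurable => omega _.
      by rewrite mule_ge0// lee_fin.
    rewrite /cst -EFinM lee_fin indicE.
    have [|_] := boolP (init omega \in G); last by rewrite mul0r.
    by rewrite inE /G /= mul1r => wN; rewrite /shifted_weight lerD2r.
  by rewrite integral_cst_prob.
have esl m : e m <= sl m + (kappa^-1 * W)%:E.
  apply: (@le_trans _ _ (\int[P]_omega
      (discounted rho G m omega * (\1_(Some @` Sl l) (state omega m))%:E +
       (kappa^-1)%:E * discounted_weight w rho b G m omega))).
    apply: le_integral_nonmeasurable => omega _; first exact: discounted_ge0.
    rewrite /discounted_weight -/(discounted rho G m omega).
    case: (trajectory_cases m omega) => [[t [x [t0 tE sx hfin]]]|[tE -> hoo]].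
      have k0 : (0 <= kappa^-1)%R by rewrite invr_ge0 ltW.
      rewrite sx [X in _ + X]muleCA -EFinM -ge0_muleDr ?lee_fin ?mulr_ge0//;
        last exact: (wt_ge0 x).
      rewrite -[leLHS]mule1 lee_wpmul2l//.
      rewrite -EFinD lee_fin indicE.
      have [_|] := boolP (Some x \in Some @` Sl l).
        by rewrite lerDl; exact: mulr_ge0 k0 (wt_ge0 x).
      move=> xS; rewrite add0r mulrC ler_pdivlMr// mul1r.
      apply: (@le_trans _ _ (w x)); last by rewrite lerDl divr_ge0// ltW.
      by apply: Sl_kappa => Sx; move/negP: xS; apply; rewrite inE; exists x.
    by rewrite /discounted tE discount_factor_pinfty// !(mule0, mul0e) adde0.
  rewrite ge0_integralD//; last 4 first.
  - by move=> omega _; rewrite mule_ge0// ?discounted_ge0// lee_fin.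
  - exact: emeasurable_funM.
  - move=> omega _; rewrite mule_ge0 ?weight_ge0// lee_fin invr_ge0.
    exact: ltW.
  - exact: measurable_funeM.
  rewrite leeD2l// ge0_integralZl_EFin//; last by rewrite invr_ge0 ltW.
  by rewrite EFinM lee_wpmul2l// lee_fin invr_ge0 ltW.
have e1 m : 0 <= e m <= 1 by exact: integral_le1.
have s1 m : 0 <= sl m <= 1.
  apply: integral_le1 => omega; first by rewrite mule_ge0// ?discounted_ge0// lee_fin.
  rewrite -[leRHS]mule1; apply: lee_pmul.
  - exact: discounted_ge0.
  - by rewrite lee_fin.
  - exact: discounted_le1.
  - by rewrite lee_fin indicE; case: (_ \in _).
have fin1 (x : \bar R) : 0 <= x <= 1 -> x \is a fin_num.
  by move=> /andP[x0 x1]; rewrite ge0_fin_numE// (le_lt_trans x1)// ltry.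
have eE m : e m = (fine (e m))%:E by rewrite fineK// fin1.
have sE' m : sl m = (fine (sl m))%:E by rewrite fineK// fin1.
have bound := @contraction_rate R (fun m => fine (e m)) (fun m => fine (sl m))
  (rho / (K + rho)) (kappa^-1 * W).
have {}bound : forall n, (n%:R * fine (e n) <= (rho / (K + rho))^-1 + n%:R * (kappa^-1 * W))%R.
  apply: bound => [|m|m||m|m].
  - by rewrite divr_gt0.
  - by rewrite fine_ge0//; case/andP: (e1 m).
  - by rewrite fine_ge0//; case/andP: (s1 m).
  - by rewrite -lee_fin -eE; case/andP: (e1 0%N).
  - by rewrite -lee_fin EFinD EFinM -!eE -sE'; exact: es.
  - by rewrite -lee_fin EFinD -eE -sE'; exact: esl.
(* After [n] steps the inner part, which is at most [(K + rho) / (rho * n)], is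
   below [eps / 2] as well. *)
pose n := (Num.bound (2 * (rho / (K + rho))^-1 / eps)%R).
have n0 : (2 * (rho / (K + rho))^-1 / eps < n%:R)%R.
  apply: archi_boundP; rewrite divr_ge0 ?(ltW eps0)// mulr_ge0//.
  by rewrite invr_ge0 divr_ge0// ltW.
have npos : (0 < n%:R :> R)%R.
  apply: le_lt_trans n0; rewrite divr_ge0 ?(ltW eps0)// mulr_ge0//.
  by rewrite invr_ge0 divr_ge0// ltW.
exists n; rewrite eE lee_fin -(ler_pM2l npos); apply: le_trans (bound n) _.
have h1 : (2 * (rho / (K + rho))^-1 < n%:R * eps)%R by rewrite -ltr_pdivrMr.
have h2 : (2 * (kappa^-1 * W) <= eps)%R.
  rewrite mulrCA ler_pdivrMl// /kappa divfK ?gt_eqF//.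
  rewrite ler_wpM2l//; lra.
have := ler_wpM2l (ltW npos) h2; lra.
Qed.

End level.
Let bounded_path (n : nat) : set (trajectory R S) :=
  [set omega | (w (init omega) <= n%:R)%R] `&`
  \bigcap_m [set omega | jump_time omega m <= n%:R%:E].

Let measurable_bounded_path n : measurable (bounded_path n).
Proof.
apply: measurableI.
  have : measurable_fun setT (fun omega : trajectory R S => w (init omega) <= n%:R)%R.
    apply: measurable_fun_ler => //.
    exact: measurableT_comp mw (@measurable_init _ _ _).
  by move=> /(_ measurableT [set true] I); rewrite setTI.
apply: bigcapT_measurable => m.
rewrite -[X in measurable X]setTI; apply: measurable_lee => //.
exact: measurable_jump_time.
Qed.

Let bounded_path_null n : P (bounded_path n) = 0.
Proof.
apply/eqP; rewrite eq_le measure_ge0 andbT; apply/lee_addgt0Pr => eps eps0.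
rewrite add0e; pose c := expR (- (rho * n%:R)).
have c0 : (0 < c)%R by exact: expR_gt0.
have [m] := @discounted_small n (eps * c) (mulr_gt0 eps0 c0).
set G := [set x | (w x <= n%:R)%R] => em.
rewrite -(@lee_pmul2r _ c%:E) ?lte_fin// -EFinM; apply: le_trans em.
rewrite muleC -(integral_cst P (measurable_bounded_path n)) integral_mkcond.
apply: le_integral_nonmeasurable => omega _; rewrite patchE; case: ifPn => //.
- by move=> _; rewrite lee_fin ltW.
- move=> /set_mem[wn Tn]; rewrite /discounted indicE mem_set// mul1e.
  rewrite /cst /c -discount_factorE /discount_factor lee_expeR leeN2.
  by rewrite lee_wpmul2l ?lee_fin ?(ltW rho_gt0)//; exact: Tn.
- by move=> _; rewrite mule_ge0 ?discount_factor_ge0// lee_fin.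
Qed.

Let explosionE : [set omega : trajectory R S | explosion_time omega = +oo] =
  ~` \bigcup_n bounded_path n.
Proof.
apply/seteqP; split => omega /=.
  move=> Too [n _ [_ Tn]]; have : explosion_time omega <> +oo.
    by apply/explosion_timeP; exists n => m; exact: Tn.
  by [].
move=> H; apply: contrapT => /explosion_timeP[t Tt]; apply: H.
pose N := Num.bound (w (init omega)).
exists (maxn N t) => //; split => [/=|m _ /=].
  apply: (@le_trans _ _ N%:R); last by rewrite ler_nat leq_maxl.
  by rewrite ltW// archi_boundP.
apply: (le_trans (Tt m)); rewrite lee_fin ler_nat.
exact: leq_maxr.
Qed.

(** Explosion is the union over [n] of the events that the initial weight and all
    jump times are at most [n]. There the discount factor stays above
    [e^{- rho n}], which contradicts [discounted_small] unless the event is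
    null. *)
Lemma nonexplosion : P [set omega | explosion_time omega = +oo] = 1.
Proof.
rewrite explosionE probability_setC; last exact: bigcupT_measurable.
rewrite (measure_negligible (mu := P)) ?sube0//; first exact: bigcupT_measurable.
apply: negligible_bigcup => n; apply/negligibleP => //.
exact: bounded_path_null.
Qed.

End nonexplosion.

(** * The state at a fixed time *)

Section time_cut.
Context (R : realType) d (S : measurableType d).
Variables (D : set (\bar R)) (t : R).
Hypotheses (D_le : forall s, D s -> s <= t%:E) (D_lt : forall s, s < t%:E -> D s).

(** For a down-closed set [D] of times, the state reached by the [m]-th jump is
    the current one when [D] ends. With [D] the times up to [t] this describes
    [xi] at time [t], with [D] the times before [t] its left limit; the
    hypotheses [D_le] and [D_lt] express that [D] is one of the two. *)
Definition sits (m : nat) (omega : trajectory R S) : bool :=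
  `[< D (jump_time omega m) /\ ~ D (jump_time omega m.+1) >].

Definition state_at (omega : trajectory R S) : option S :=
  xget None [set x | exists m, sits m omega /\ x = state omega m].

Lemma cut_down x y : x <= y -> D y -> D x.
Proof.
by rewrite le_eqVlt => /predU1P[->//|xy Dy]; apply: D_lt; exact: lt_le_trans (D_le Dy).
Qed.

Lemma sits_unique omega m n : sits m omega -> sits n omega -> m = n.
Proof.
wlog mn : m n / (m <= n)%N.
  by move=> H sm sn; have [mn|/ltnW nm] := leqP m n; [|apply/esym]; exact: H.
move=> /asboolP[Dm nDm] /asboolP[Dn _]; apply/eqP; rewrite eqn_leq mn leqNgt /=.
by apply/negP => lt_mn; apply: nDm; apply: cut_down Dn; exact: jump_time_nd.
Qed.

Lemma state_at_sits omega m : sits m omega -> state_at omega = state omega m.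
Proof.
move=> sm; rewrite /state_at; case: xgetP => [x _ [n [sn ->]]|none].
  by rewrite (sits_unique sn sm).
by case: (none (state omega m)); exists m.
Qed.

(** At most one summand does not vanish. Written as a series, [f (state_at omega)]
    is visibly measurable and can be integrated term by term. *)
Lemma state_atE (f : option S -> \bar R) omega : (forall o, 0 <= f o) ->
  f None = 0 ->
  f (state_at omega) = \sum_(m <oo) if sits m omega then f (state omega m) else 0.
Proof.
move=> f0 fN; have [[m sm]|none] := pselect (exists m, sits m omega).
  rewrite (state_at_sits sm) (@nneseriesD1 _ _ m)//; last first.
    by move=> n _; case: ifP.
  rewrite sm eseries0 ?adde0// => n _ /= nm; case: ifPn => // sn.
  by rewrite (sits_unique sn sm) eqxx in nm.
rewrite eseries0; last by move=> n _ _; case: ifPn => // sn; case: none; exists n.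
rewrite /state_at xgetPN// => x [m [sm _]].
by apply: none; exists m.
Qed.

Lemma sits_state omega m : sits m omega -> state omega m <> None.
Proof.
move=> /asboolP[/D_le Tm _].
by case: (trajectory_cases m omega) => [[u [x [_ _ -> _]]]//|[Too _ _]]; rewrite Too in Tm.
Qed.

Lemma state_at_neq_None omega : ~ D +oo -> D 0 ->
  explosion_time omega = +oo -> state_at omega <> None.
Proof.
move=> nDoo D0 Too.
have [m Dm] : exists m, ~ D (jump_time omega m).
  apply: contrapT => H; have : explosion_time omega <> +oo; last by [].
  apply/explosion_timeP; exists (Num.bound t) => m.
  have Dm : D (jump_time omega m) by apply: contrapT => nDm; apply: H; exists m.
  apply: le_trans (D_le Dm) _; rewrite lee_fin ltW// archi_boundP//.
  by rewrite -lee_fin; exact: D_le.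
have : exists m, `[< ~ D (jump_time omega m) >] by exists m; apply/asboolP.
case/ex_minnP => -[|n] /asboolP nD minD.
  by case: nD; rewrite jump_time0.
have sn : sits n omega.
  apply/asboolP; split => //; apply: contrapT => nDn.
  by have := minD n (asboolT nDn); rewrite ltnn.
by rewrite (state_at_sits sn); exact: sits_state.
Qed.

Hypothesis mD : measurable D.

Lemma measurable_sits m : measurable_fun setT (sits m).
Proof.
rewrite (_ : sits m = fun omega => `[< D (jump_time omega m) >] &&
    ~~ `[< D (jump_time omega m.+1) >]).
  apply: measurable_and.
    exact: measurableT_comp (measurable_asbool mD) (@measurable_jump_time _ _ _ m).
  apply: measurable_neg.
  exact: measurableT_comp (measurable_asbool mD) (@measurable_jump_time _ _ _ m.+1).
by apply/funext => omega; rewrite /sits asbool_and asbool_neg.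
Qed.

End time_cut.

Lemma xi_state_at (R : realType) d (S : measurableType d)
    (omega : trajectory R S) (t : R) :
  xi omega t = state_at [set s | s <= t%:E] omega.
Proof.
congr (xget None _); apply/seteqP; split => x [m [h ->]]; exists m; split => //.
  by case/andP: h => h1 h2; apply/asboolP; split => //=; rewrite leNgt h2.
by move/asboolP : h => /= [-> /negP]; rewrite -ltNge.
Qed.

Lemma xi_left_state_at (R : realType) d (S : measurableType d)
    (omega : trajectory R S) (t : R) : t != 0%R ->
  xi_left omega t = state_at [set s | s < t%:E] omega.
Proof.
move=> t0; rewrite /xi_left (negbTE t0).
congr (xget None _); apply/seteqP; split => x [m [h ->]]; exists m; split => //.
  by case/andP: h => h1 h2; apply/asboolP; split => //=; apply/negP; rewrite -leNgt.
by move/asboolP : h => /= [-> /negP]; rewrite -leNgt.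
Qed.

Section moment.
Context (R : realType) dS dA (S : measurableType dS) (A : measurableType dA).
Variable M : ctmdp R S A.
Hypothesis mS1 : forall x, measurable ([set x] : set S).
Variable E : nat -> set S.
Hypotheses (mE : forall n, measurable (E n)) (sE : separating E).
Variable Sl : nat -> set S.
Hypotheses (mSl : forall l, measurable (Sl l)) (Sl_cover : \bigcup_l Sl l = setT).
Hypothesis rate_bounded :
  forall l, ereal_sup [set exit_rate M x | x in Sl l] < +oo.
Variable k : kernel_family R S A.
Variables (w : S -> R) (rho b : R).
Hypotheses (mw : measurable_fun setT w) (w_ge0 : forall x, (0 <= w x)%R).
Hypotheses (rho_gt0 : (0 < rho)%R) (b_ge0 : (0 <= b)%R).
Hypothesis drift : forall x a, adm M x a ->
  charge_integral (rate M x a) (fun y => (w y)%:E) <= (rho * w x + b)%:E.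
Variable P : probability (trajectory R S) R.
Local Notation step_t := (\bar R * option S)%type.
Hypothesis P_jump : forall m (B : set (hist R S m)) (C : set step_t),
  measurable B -> measurable C ->
  P ((history m @^-1` B) `&` [set omega | C (step omega m)]) =
  \int[P]_(omega in history m @^-1` B) jump_law M k (history m omega) C.
Local Notation wt := (shifted_weight w rho b).
Local Notation disc := (discount_factor rho).
Local Notation jump_kernel m :=
  (@jump_kernel R dS dA S A M mS1 E mE sE Sl mSl Sl_cover rate_bounded k m).

Let wt_ge0 x : (0 <= wt x)%R.
Proof. exact: shifted_weight_ge0. Qed.

Let owt (o : option S) : \bar R := (oapp wt 0%R o)%:E.

Let owt_ge0 o : 0 <= owt o.
Proof. by rewrite lee_fin; case: o. Qed.

Let measurable_owt : measurable_fun setT owt.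
Proof.
apply: measurable_fun_option.
by apply/measurable_EFinP; exact: measurable_shifted_weight.
Qed.

Let mdisc : measurable_fun setT disc.
Proof. exact: measurable_discount_factor. Qed.

Let disc_ge0 s : 0 <= disc s.
Proof. exact: discount_factor_ge0. Qed.

Section cut.
Variables (D : set (\bar R)) (t : R).
Hypotheses (D_le : forall s, D s -> s <= t%:E) (D_lt : forall s, s < t%:E -> D s).
Hypothesis mD : measurable D.

Let running m (omega : trajectory R S) : \bar R :=
  if `[< D (jump_time omega m) >]
  then disc (jump_time omega m) * owt (state omega m) else 0.

Let sitting m (omega : trajectory R S) : \bar R :=
  if sits D m omega then owt (state omega m) else 0.

Let discount_factorDl (x : R) (y : \bar R) :
  disc (x%:E + y) = disc x%:E * disc y.
Proof.
rewrite /discount_factor -expeRD muleDr// ?fin_num_adde_defr// oppeD//.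
Qed.

Let mrunning m : measurable_fun setT (running m).
Proof.
apply: measurable_fun_ifT => //.
  exact: measurableT_comp (measurable_asbool mD) (@measurable_jump_time _ _ _ m).
apply: emeasurable_funM.
  exact: measurableT_comp mdisc (@measurable_jump_time _ _ _ m).
exact: measurableT_comp measurable_owt (@measurable_state _ _ _ m).
Qed.

Let msitting m : measurable_fun setT (sitting m).
Proof.
apply: measurable_fun_ifT => //; first exact: measurable_sits.
exact: measurableT_comp measurable_owt (@measurable_state _ _ _ m).
Qed.

Let running_ge0 m omega : 0 <= running m omega.
Proof. by rewrite /running; case: ifP => // _; exact: mule_ge0. Qed.

Let sitting_ge0 m omega : 0 <= sitting m omega.
Proof. by rewrite /sitting; case: ifP. Qed.

Let stopped_step m :
  (expR (- (rho * t)))%:E * \int[P]_omega sitting m omega +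
  \int[P]_omega running m.+1 omega <= \int[P]_omega running m omega.
Proof.
pose g (z : hist R S m * step_t) : \bar R :=
  if `[< D (hist_time z.1) >] then
    if `[< D (hist_time z.1 + z.2.1) >]
    then disc (hist_time z.1 + z.2.1) * owt z.2.2
    else (expR (- (rho * t)))%:E * owt (last_step z.1).2
  else 0.
have mlast : measurable_fun setT (fun z : hist R S m * step_t => hist_time z.1).
  by apply: measurableT_comp => //; exact: measurable_hist_time.
have mnext : measurable_fun setT
    (fun z : hist R S m * step_t => hist_time z.1 + z.2.1).
  by apply: emeasurable_funD => //; apply: measurableT_comp.
have mg : measurable_fun setT g.
  apply: measurable_fun_ifT => //; first exact: measurableT_comp (measurable_asbool mD) mlast.
  apply: measurable_fun_ifT.
  - exact: measurableT_comp (measurable_asbool mD) mnext.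
  - apply: emeasurable_funM; first exact: measurableT_comp mdisc mnext.
    by apply: measurableT_comp => //; apply: measurableT_comp.
  - apply: measurable_funeM; apply: measurableT_comp => //.
    apply: measurableT_comp => //; apply: measurableT_comp => //.
    exact: measurable_last_step.
have g0 z : 0 <= g z.
  by rewrite /g; case: ifP => // _; case: ifP => _; apply: mule_ge0.
rewrite -ge0_integralZl_EFin ?expR_ge0// -ge0_integralD//; last first.
- exact: measurable_funeM.
- by move=> omega _; apply: mule_ge0 => //; rewrite lee_fin expR_ge0.
rewrite [leLHS](_ : _ = \int[P]_omega g (history m omega, step omega m)); last first.
  apply: eq_integral => omega _; rewrite /g /= hist_time_history -jump_timeS.
  rewrite /sitting /running /sits last_step_history /=.
  have nd : D (jump_time omega m.+1) -> D (jump_time omega m).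
    by apply: (cut_down D_le D_lt); exact: jump_time_nd.
  case: (asboolP (D (jump_time omega m.+1))) => [Dn|nDn].
    rewrite (asboolT (nd Dn)); case: asboolP => [[_]//|_].
    by rewrite mule0 add0e.
  case: (asboolP (D (jump_time omega m))) => Dm.
    by rewrite asboolT// adde0.
  by case: asboolP => [[]//|_]; rewrite mule0 adde0.
apply: (@expectation_step_le _ _ _ _ _ M mS1 E mE sE Sl mSl Sl_cover rate_bounded k P P_jump _ g _ mg g0).
move=> omega; rewrite /g /= hist_time_history /running last_step_history.
case: asboolP => [Dm|_]; last by rewrite integral0_eq.
case: (trajectory_cases m omega) => [[u [x [u0 uE sx hfin]]]|[Too _ _]]; last first.
  by move: (D_le Dm); rewrite Too.
rewrite uE in Dm *; rewrite sx.
have ut : (u <= t)%R by rewrite -lee_fin; exact: D_le.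
(* Shift the origin of time to the last jump: [D'] are the waiting times that end
   within [D]. *)
pose D' : set (\bar R) := [set s | D (u%:E + s)].
pose f (s : step_t) : \bar R := if `[< D' s.1 >] then disc s.1 * owt s.2
  else (expR (- (rho * (t - u))) * wt x)%:E.
have mD' : measurable D'.
  have ms : measurable_fun setT (fun s : \bar R => u%:E + s).
    exact: emeasurable_funD.
  by rewrite /D' -[X in measurable X]setTI; exact: ms.
have mf : measurable_fun setT f.
  apply: measurable_fun_ifT => //.
    exact: measurableT_comp (measurable_asbool mD') measurable_fst.
  by apply: emeasurable_funM; apply: measurableT_comp.
have f0 s : 0 <= f s.
  rewrite /f; case: ifP => _; first exact: mule_ge0.
  by rewrite lee_fin mulr_ge0 ?expR_ge0.
rewrite [leLHS](_ : _ = disc u%:E * \int[jump_kernel m (history m omega)]_s f s).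
  rewrite lee_wpmul2l//; apply: jump_kernel_stopped_le => //.
  - by rewrite last_step_history.
  - by rewrite subr_ge0.
  - by move=> v Dv; rewrite lerBrDl -lee_fin EFinD; exact: D_le.
  - move=> v nDv; rewrite lerBlDl leNgt; apply/negP => vt; apply: nDv.
    by apply: D_lt; rewrite -EFinD lte_fin.
  - by move=> Doo; have := D_le Doo.
rewrite discount_factorE -ge0_integralZl_EFin ?expR_ge0//.
apply: eq_integral => s _; rewrite /f -/(D' s.1).
case: (asboolP (D' s.1)) => _.
  by rewrite discount_factorDl discount_factorE muleA.
rewrite -!EFinM mulrA -expRD /=; congr (expR _ * _)%:E.
by rewrite mulrBr; lra.
Qed.

Let stopped_sum n :
  (expR (- (rho * t)))%:E * \sum_(m < n) \int[P]_omega sitting m omega +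
  \int[P]_omega running n omega <= \int[P]_omega running 0 omega.
Proof.
elim: n => [|n IH]; first by rewrite big_ord0 mule0 add0e.
apply: le_trans IH; rewrite big_ord_recr/= ge0_muleDr; last 2 first.
- by apply: sume_ge0 => i _; exact: integral_ge0.
- exact: integral_ge0.
by rewrite -addeA leeD2l// stopped_step.
Qed.

(** Telescope the one-step inequality of the process stopped at [t]: the sums
    below count the weight of the current state at the jump where [D] ends, the
    remainder counts the discounted weight of the trajectories that are still
    running. *)
Lemma stopped_weight_le :
  \int[P]_omega owt (state_at D omega) <=
  (expR (rho * t))%:E * \int[P]_omega (wt (init omega))%:E.
Proof.
under eq_integral => omega _.
  rewrite (state_atE D_le D_lt (f := owt))//; over.
rewrite (@integral_nneseries _ _ _ P _ measurableT sitting)//.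
apply: lime_le; first by apply: is_cvg_nneseries => n _ _; exact: integral_ge0.
apply: nearW => n; rewrite big_mkord.
have e0 : (0 < expR (- (rho * t)))%R by exact: expR_gt0.
rewrite -(@lee_pmul2l _ (expR (- (rho * t)))%:E) ?lte_fin//.
rewrite muleA -EFinM -expRD addNr expR0 mul1e.
apply: (@le_trans _ _ (\int[P]_omega running 0 omega)).
  by apply: le_trans (stopped_sum n); rewrite leeDl// integral_ge0.
apply: le_integral_nonmeasurable => omega _ //; rewrite /running.
case: ifP => _; last by rewrite lee_fin.
by rewrite jump_time0 discount_factorE mulr0 oppr0 expR0 mul1e.
Qed.

End cut.
End moment.

Section process_law.
Context (R : realType) d (S : measurableType d).
Variable P : probability (trajectory R S) R.
Variables (D : set (\bar R)) (t : R).
Hypotheses (D_le : forall s, D s -> s <= t%:E) (D_lt : forall s, s < t%:E -> D s).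
Hypotheses (mD : measurable D) (D0 : D 0).

Let nDoo : ~ D +oo.
Proof. by move=> /D_le. Qed.

Lemma state_at_neq_NoneE :
  [set omega : trajectory R S | state_at D omega <> None] =
  \bigcup_m [set omega | sits D m omega].
Proof.
apply/seteqP; split => omega /=.
  rewrite /state_at; case: xgetP => [x _ [m [sm _]] _|//].
  by exists m.
move=> [m _ sm]; rewrite (state_at_sits D_le D_lt sm).
exact: (sits_state D_le sm).
Qed.

Lemma measurable_state_at_neq_None :
  measurable [set omega : trajectory R S | state_at D omega <> None].
Proof.
rewrite state_at_neq_NoneE; apply: bigcupT_measurable => m.
by have := @measurable_sits _ _ S _ mD m measurableT [set true] I; rewrite setTI.
Qed.

Lemma state_at_neq_None_as :
  P [set omega | explosion_time omega = +oo] = 1 ->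
  P [set omega | state_at D omega <> None] = 1.
Proof.
move=> PT; apply/eqP; rewrite eq_le probability_le1 ?andTb; last first.
  exact: measurable_state_at_neq_None.
rewrite -PT; apply: le_measure; rewrite ?inE//.
- exact: measurable_explosion.
- exact: measurable_state_at_neq_None.
- by move=> omega /=; exact: (state_at_neq_None D_le D_lt).
Qed.

Lemma measurable_state_at (f : option S -> \bar R) : (forall o, 0 <= f o) ->
  f None = 0 -> measurable_fun setT f ->
  measurable_fun setT (fun omega : trajectory R S => f (state_at D omega)).
Proof.
move=> f0 fN mf; rewrite (_ : (fun omega => _) = fun omega : trajectory R S =>
    \sum_(m <oo) if sits D m omega then f (state omega m) else 0); last first.
  by apply/funext => omega; exact: (state_atE D_le D_lt).
apply: ge0_emeasurable_sum => [m omega _ _|m _]; first by case: ifP.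
apply: measurable_fun_ifT => //; first exact: measurable_sits.
exact: measurableT_comp mf (@measurable_state _ _ _ m).
Qed.

Variables (w : S -> R) (rho b : R).
Hypotheses (mw : measurable_fun setT w) (w_ge0 : forall x, (0 <= w x)%R).
Hypotheses (rho_gt0 : (0 < rho)%R) (b_ge0 : (0 <= b)%R).

Let ow (o : option S) : \bar R := (oapp w 0%R o)%:E.

Let mow : measurable_fun setT ow.
Proof. by apply: measurable_fun_option; exact/measurable_EFinP. Qed.

Let ow_ge0 o : 0 <= ow o.
Proof. by rewrite lee_fin; case: o. Qed.

(** The shift [b / rho] contributes its full value as the state is almost surely
    different from [None]. *)
Lemma integral_shifted_state_at :
  P [set omega | state_at D omega <> None] = 1 ->
  \int[P]_omega (oapp (shifted_weight w rho b) 0%R (state_at D omega))%:E =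
  \int[P]_omega (oapp w 0%R (state_at D omega))%:E + (b / rho)%:E.
Proof.
move=> PN; have br : (0 <= b / rho)%R by rewrite divr_ge0// ltW.
pose N := [set omega : trajectory R S | state_at D omega <> None].
have mN : measurable N by exact: measurable_state_at_neq_None.
transitivity (\int[P]_omega (ow (state_at D omega) + (b / rho)%:E * (\1_N omega)%:E)).
  apply: eq_integral => omega _; rewrite /ow indicE.
  case: (boolP (omega \in N)) => oN.
    move: oN; rewrite inE /N /=; case: (state_at D omega) => //= x _.
    by rewrite mule1.
  have -> : state_at D omega = None.
    by apply: contrapT => H; move/negP: oN; apply; exact: mem_set.
  by rewrite mule0 adde0.
rewrite ge0_integralD//; last 3 first.
- exact: measurable_state_at.
- by move=> omega _; rewrite mule_ge0// lee_fin.
- by apply: measurable_funeM; apply/measurable_EFinP; exact: measurable_indic.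
congr (_ + _); rewrite ge0_integralZl_EFin//; last first.
  by apply/measurable_EFinP; exact: measurable_indic.
by rewrite integral_indic// setIT [X in _ * X]PN mule1.
Qed.

End process_law.

(** * Tonelli for the state just before a time *)

Local Notation before t := [set s : \bar _ | s < t%:E].

Section state_before.
Context (R : realType) d (S : measurableType d).
Variable P : probability (trajectory R S) R.
Variable f : option S -> \bar R.
Hypotheses (f_ge0 : forall o, 0 <= f o) (fN : f None = 0).
Hypothesis mf : measurable_fun setT f.

Let before_le (t : R) s : before t s -> s <= t%:E.
Proof. exact: ltW. Qed.

Let before_lt (t : R) s : s < t%:E -> before t s.
Proof. by []. Qed.

Lemma state_before_le0 (omega : trajectory R S) (t : R) : (t <= 0)%R ->
  state_at (before t) omega = None.
Proof.
move=> t0; rewrite /state_at xgetPN// => x [m [/asboolP[/= Tm _] _]].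
have := lt_le_trans Tm (_ : t%:E <= 0); rewrite lee_fin t0 => /(_ isT).
by rewrite ltNge jump_time_ge0.
Qed.

(** The series [state_atE] is used with the time as a second variable. *)
Lemma measurable_state_before :
  measurable_fun setT (fun z : trajectory R S * measurableTypeR R =>
    f (state_at (before z.2) z.1)).
Proof.
rewrite (_ : (fun z => _) = fun z : trajectory R S * measurableTypeR R =>
    \sum_(m <oo) if (jump_time z.1 m < z.2%:E) && ~~ (jump_time z.1 m.+1 < z.2%:E)
      then f (state z.1 m) else 0); last first.
  apply/funext => -[omega t] /=.
  rewrite (state_atE (@before_le t) (@before_lt t))//.
  apply: eq_eseriesr => m _; congr (if _ then _ else _).
  by rewrite /sits /= asbool_and asbool_neg !asboolb.
apply: ge0_emeasurable_sum => [m z _ _|m _]; first by case: ifP.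
have mT n : measurable_fun setT (fun z : trajectory R S * measurableTypeR R =>
    jump_time z.1 n < z.2%:E).
  apply: measurable_fun_lte.
    exact: measurableT_comp (@measurable_jump_time _ _ _ n) measurable_fst.
  by apply/measurable_EFinP; exact: measurable_snd.
apply: measurable_fun_ifT => //.
  by apply: measurable_and => //; apply: measurable_neg.
apply: measurableT_comp mf _.
exact: measurableT_comp (@measurable_state _ _ _ m) measurable_fst.
Qed.

Variable g : R -> R.
Hypotheses (g_ge0 : forall t, (0 <= g t)%R) (mg : measurable_fun setT g).

(** Tonelli on the product of the trajectories with the real line. Before time 0 no
    jump has happened, so [state_at (before t)] is [None], [f] vanishes, and both
    time integrals can be taken over the whole line; the time [t = 0], where
    [xi_left] has a value of its own, is a null set. *)
Lemma integral_state_before :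
  \int[P]_omega \int[lebesgue_measure]_(t in `[0%R, +oo[)
    ((g t)%:E * f (xi_left omega t)) =
  \int[lebesgue_measure]_(t in `]0%R, +oo[)
    ((g t)%:E * \int[P]_omega f (state_at (before t) omega)).
Proof.
pose F (z : trajectory R S * measurableTypeR R) :=
  (g z.2)%:E * f (state_at (before z.2) z.1).
have mF : measurable_fun setT F.
  apply: emeasurable_funM; last exact: measurable_state_before.
  by apply/measurable_EFinP; exact: measurableT_comp mg measurable_snd.
have F0 z : 0 <= F z by rewrite mule_ge0// lee_fin.
transitivity (\int[P]_omega \int[@lebesgue_measure R]_t F (omega, t)).
  apply: eq_integral => omega _.
  rewrite -integral_itv_obnd_cbnd; last first.
    apply: (@eq_measurable_fun _ _ _ _ _ (fun t => F (omega, t))).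
      move=> t; rewrite inE /= in_itv /= andbT => t0.
      by rewrite /F /= xi_left_state_at// gt_eqF.
    apply: measurable_funTS; exact: measurableT_comp mF (pair1_measurable omega).
  rewrite integral_mkcond; apply: eq_integral => t _.
  rewrite patchE /F /=; case: ifPn.
    rewrite inE /= in_itv /= andbT => t0.
    by rewrite xi_left_state_at// gt_eqF.
  rewrite notin_setE /= in_itv /= andbT => /negP; rewrite -leNgt => t0.
  by rewrite state_before_le0// fN mule0.
rewrite fubini_tonelli// [RHS]integral_mkcond; apply: eq_integral => t _.
rewrite patchE /F /=; case: ifPn => [_|].
  rewrite ge0_integralZl_EFin//.
  apply: (measurable_state_at (@before_le t) (@before_lt t)) => //.
  exact: emeasurable_lt.
rewrite notin_setE /= in_itv /= andbT => /negP; rewrite -leNgt => t0.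
apply: integral0_eq => omega _.
by rewrite state_before_le0// fN mule0.
Qed.

End state_before.

(** * Moment bound and performance bound *)

Section model_bounds.
Context (R : realType) dS dA (S : measurableType dS) (A : measurableType dA).
Variable M : ctmdp R S A.
Hypothesis mS1 : forall x, measurable ([set x] : set S).
Variable E : nat -> set S.
Hypotheses (mE : forall n, measurable (E n)) (sE : separating E).
Variable Sl : nat -> set S.
Hypotheses (mSl : forall l, measurable (Sl l)) (Sl_cover : \bigcup_l Sl l = setT).
Hypothesis rate_bounded :
  forall l, ereal_sup [set exit_rate M x | x in Sl l] < +oo.
Variables (w : S -> R) (rho b : R).
Hypotheses (mw : measurable_fun setT w) (w_ge0 : forall x, (0 <= w x)%R).
Hypotheses (rho_gt0 : (0 < rho)%R) (b_ge0 : (0 <= b)%R).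
Hypothesis drift : forall x a, adm M x a ->
  charge_integral (rate M x a) (fun y => (w y)%:E) <= (rho * w x + b)%:E.
Variables (pi : policy M) (gamma : probability S R).
Variable P : probability (trajectory R S) R.
Hypothesis P_law : strategic_measure gamma pi P.
Hypothesis P_explosion : P [set omega | explosion_time omega = +oo] = 1.

(** [stopped_weight_le] with the shift removed on both sides. *)
Lemma expected_weight_le (D : set (\bar R)) (t W : R) :
  (forall s, D s -> s <= t%:E) -> (forall s, s < t%:E -> D s) ->
  measurable D -> D 0 -> \int[gamma]_y (w y)%:E = W%:E ->
  \int[P]_omega (oapp w 0%R (state_at D omega))%:E <=
  (expR (rho * t) * (W + b / rho) - b / rho)%:E.
Proof.
move=> D_le D_lt mD D0 gW.
have [k [_ Pinit P_jump]] := P_law.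
have br : (0 <= b / rho)%R by rewrite divr_ge0// ltW.
have PN := state_at_neq_None_as D_le D_lt mD D0 P_explosion.
have := stopped_weight_le mS1 mE sE mSl Sl_cover rate_bounded mw w_ge0 rho_gt0 b_ge0
  drift P_jump D_le D_lt mD.
rewrite (integral_shifted_state_at D_le D_lt mD mw w_ge0 rho_gt0 b_ge0 PN).
have mwt : measurable_fun setT (fun x => (shifted_weight w rho b x)%:E).
  by apply/measurable_EFinP; exact: measurable_shifted_weight.
have wt0 x : 0 <= (shifted_weight w rho b x)%:E.
  by rewrite lee_fin; exact: shifted_weight_ge0.
rewrite (integral_init mwt wt0 Pinit).
have -> : \int[gamma]_x (shifted_weight w rho b x)%:E = (W + b / rho)%:E.
  under eq_integral do rewrite EFinD.
  rewrite ge0_integralD//; [|by move=> x _; rewrite lee_fin|exact/measurable_EFinP].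
  by rewrite gW integral_cst_prob.
by rewrite -EFinM EFinB leeBrDr.
Qed.

Variables (Mc c : R).
Hypotheses (Mc_ge0 : (0 <= Mc)%R) (c_ge0 : (0 <= c)%R).
Hypothesis cost_ge : forall x a, adm M x a -> (- (Mc * w x + c) <= cost M x a)%R.

Let B (o : option S) : R := oapp (fun x => Mc * w x + c)%R 0%R o.

Let B_ge0 o : (0 <= B o)%R.
Proof. by case: o => //= x; rewrite addr_ge0// mulr_ge0. Qed.

Let mB : measurable_fun setT (fun o => (B o)%:E).
Proof.
apply: measurable_fun_option; apply/measurable_EFinP.
by apply: measurable_funD => //; exact: measurable_funM.
Qed.

(** The mass that [mu] gives to the admissible actions is at most 1, and the bound
    [B] on the negative cost is nonnegative. At [None] both sides vanish. *)
Lemma action_cost_ge (o : option S) (mu : probability (option A) R) :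
  - (B o)%:E <= \int[mu]_(a in adm_ext M o) (cost_ext M o a)%:E.
Proof.
have madm : measurable (adm_ext M o).
  case: o => [x|]; rewrite /measurable /=.
    rewrite (_ : _ @^-1` _ = adm M x); first exact: adm_measurable.
    by apply/seteqP; split => [a [a' ? [<-]]|a ?]//; exists a.
  by rewrite (_ : _ @^-1` _ = set0)//; apply/seteqP; split.
apply: (@le_trans _ _ (- \int[mu]_(a in adm_ext M o) (B o)%:E)).
  rewrite leeN2 integral_cst// -[leRHS]mule1.
  by rewrite lee_wpmul2l ?lee_fin// probability_le1.
apply: integral_ge_opp => [a _|a]; first by rewrite lee_fin.
case: o {madm} => [x [a' ax <-]|->]; last by rewrite /= oppr0.
by rewrite -EFinN lee_fin; exact: cost_ge.
Qed.

Lemma performance_ge_weight (alpha := discount M) :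
  - (\int[lebesgue_measure]_(t in `]0%R, +oo[)
      ((expR (- alpha * t))%:E *
       \int[P]_omega (B (state_at (before t) omega))%:E)) <=
  performance pi P.
Proof.
rewrite -(@integral_state_before _ _ _ _ (fun o => (B o)%:E) _ _ mB
    (fun t => expR (- alpha * t)))//; last first.
  by apply: measurableT_comp => //; exact: measurable_funM.
apply: integral_ge_opp => omega _.
  by apply: integral_ge0 => t _; rewrite mule_ge0// lee_fin ?expR_ge0.
apply: integral_ge_opp => t _; first by rewrite mule_ge0// lee_fin ?expR_ge0.
by rewrite -muleN lee_wpmul2l ?lee_fin ?expR_ge0//; exact: action_cost_ge.
Qed.

(** The moment bound leaves
    [\int_0^oo e^{- alpha t} (Mc * (e^{rho t} (W + b / rho) - b / rho) + c) dt],
    which is computed in closed form. *)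
Lemma integral_expected_cost_le (alpha W : R) : (rho < alpha)%R ->
  \int[gamma]_y (w y)%:E = W%:E ->
  \int[lebesgue_measure]_(t in `]0%R, +oo[)
    ((expR (- alpha * t))%:E *
     \int[P]_omega (B (state_at (before t) omega))%:E) <=
  (Mc * (alpha * W + b) / (alpha * (alpha - rho)) + c / alpha)%:E.
Proof.
move=> ra gW.
have a0 : (0 < alpha)%R by exact: lt_trans ra.
have ar0 : (0 < alpha - rho)%R by rewrite subr_gt0.
pose K := (W + b / rho)%R.
have -> : (Mc * (alpha * W + b) / (alpha * (alpha - rho)) + c / alpha)%:E =
    (Mc * K / (alpha - rho) + (c - Mc * (b / rho)) / alpha)%:E.
  by congr EFin; rewrite /K; field; rewrite !gt_eqF.
rewrite -integral_expR_decayD//; apply: le_integral_nonmeasurable => t /=.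
  move=> _; rewrite mule_ge0 ?lee_fin ?expR_ge0//.
  by apply: integral_ge0 => omega _; rewrite lee_fin.
rewrite in_itv /= andbT => t0.
have D_le (s : \bar R) : s < t%:E -> s <= t%:E by exact: ltW.
have mD := emeasurable_lt t%:E.
have mow : measurable_fun setT (fun omega : trajectory R S =>
    (oapp w 0%R (state_at (before t) omega))%:E).
  apply: (measurable_state_at D_le (fun s st => st) mD
    (f := fun o : option S => (oapp w 0%R o)%:E)) => //.
    by move=> o; rewrite lee_fin; case: o.
  by apply: measurable_fun_option; exact/measurable_EFinP.
have : \int[P]_omega (B (state_at (before t) omega))%:E <=
    (Mc * (expR (rho * t) * K - b / rho) + c)%:E.
  apply: (@le_trans _ _ (\int[P]_omega
      (Mc%:E * (oapp w 0%R (state_at (before t) omega))%:E + c%:E))).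
    apply: le_integral_nonmeasurable => omega _; first by rewrite lee_fin.
    by rewrite -EFinM -EFinD lee_fin /B; case: state_at => //=; rewrite mulr0 add0r.
  rewrite ge0_integralD//; last 2 first.
  - by move=> omega _; rewrite -EFinM lee_fin mulr_ge0//; case: state_at.
  - exact: measurable_funeM.
  rewrite integral_cst_prob EFinD leeD2r// ge0_integralZl_EFin//; last first.
    by move=> omega _; rewrite lee_fin; case: state_at.
  rewrite EFinM lee_wpmul2l ?lee_fin//.
  exact: expected_weight_le.
move=> /(lee_wpmul2l (_ : 0 <= (expR (- alpha * t))%:E)).
rewrite lee_fin expR_ge0 => /(_ isT)/le_trans; apply.
rewrite -EFinM lee_fin le_eqVlt; apply/orP; left; apply/eqP.
rewrite (_ : - ((alpha - rho) * t) = - alpha * t + rho * t)%R; last by ring.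
by rewrite expRD mulNr; ring.
Qed.

End model_bounds.

Theorem theorem1 (R : realType) (dS dA : measure_display)
  (S : measurableType dS) (A : measurableType dA)
  (borelS : borel_space R S) (borelA : borel_space R A)
  (M : ctmdp R S A)
  (w : S -> R) (rho b : R) (Sl : nat -> set S)
  (w_measurable : measurable_fun setT w)
  (w_ge1 : forall x, (1 <= w x)%R)
  (rho_gt0 : (0 < rho)%R) (b_ge0 : (0 <= b)%R)
  (Sl_measurable : forall l, measurable (Sl l))
  (Sl_increasing : forall l, Sl l `<=` Sl l.+1)
  (Sl_cover : \bigcup_l Sl l = setT)
  (w_unbounded :
    (fun l => ereal_inf [set (w x)%:E | x in ~` Sl l]) @ \oo --> +oo)
  (drift : forall x a, adm M x a ->
    charge_integral (rate M x a) (fun y => (w y)%:E) <= (rho * w x + b)%:E)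
  (rate_bounded : forall l,
    ereal_sup [set exit_rate M x | x in Sl l] < +oo)
  (pi : policy M) :
  ((forall (gamma : probability S R) (P : probability (trajectory R S) R),
      strategic_measure gamma pi P ->
      P [set omega | explosion_time omega = +oo] = 1 /\
      (forall t : R, (0 <= t)%R ->
        P [set omega | xi omega t <> None] = 1)) /\
   (forall (x : S) (t : R) (P : probability (trajectory R S) R),
      (0 <= t)%R -> strategic_measure \d_x pi P ->
      'E_P[fun omega => oapp w 0%R (xi omega t)] <=
      (expR (rho * t) * w x + b / rho * (expR (rho * t) - 1))%:E)) /\
  (forall (gamma : probability S R) (P : probability (trajectory R S) R)
      (Mc c : R),
    strategic_measure gamma pi P ->
    \int[gamma]_y (w y)%:E < +oo ->
    (rho < discount M)%R ->
    (0 <= Mc)%R -> (0 <= c)%R ->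
    (forall x, `|ereal_inf [set (cost M x a)%:E | a in adm M x]| <=
               (Mc * w x + c)%:E) ->
    let alpha := discount M in
    let bound :=
      - (Mc%:E * (alpha%:E * \int[gamma]_y (w y)%:E + b%:E)
         * ((alpha * (alpha - rho))^-1)%:E) - (c / alpha)%:E in
    bound <= performance pi P /\ -oo < bound).
Proof.
have w_ge0 x : (0 <= w x)%R by exact: le_trans (w_ge1 x).
have [E mE sE] := borel_space_separating borelS.
have mS1 := separating_measurable_set1 mE sE.
have nonexpl gamma P : strategic_measure gamma pi P ->
    P [set omega | explosion_time omega = +oo] = 1.
  move=> [k [_ _ P_jump]].
  exact: (nonexplosion mS1 mE sE Sl_measurable Sl_cover rate_bounded
    w_measurable w_ge0 rho_gt0 b_ge0 drift P_jump w_unbounded).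
pose upto (t : R) := [set s : \bar R | s <= t%:E].
have upto_le t s : upto t s -> s <= t%:E by [].
have upto_lt t s : s < t%:E -> upto t s by exact: ltW.
split; [split|].
- move=> gamma P P_law; split=> [|t t0]; first exact: nonexpl P_law.
  under eq_set do rewrite xi_state_at.
  apply: (state_at_neq_None_as (@upto_le t) (@upto_lt t)).
  + exact: emeasurable_le.
  + by rewrite /upto/= lee_fin.
  + exact: nonexpl P_law.
- move=> x t P t0 P_law; rewrite unlock.
  under eq_integral do rewrite xi_state_at.
  apply: le_trans (expected_weight_le mS1 mE sE Sl_measurable Sl_cover rate_bounded
    w_measurable w_ge0 rho_gt0 b_ge0 drift P_law (nonexpl _ _ P_law) (@upto_le t)
    (@upto_lt t) (emeasurable_le _) _ (W := w x) _) _.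
  + by rewrite /upto/= lee_fin.
  + rewrite integral_dirac//; last exact/measurable_EFinP.
    by rewrite diracT mul1e.
  + rewrite lee_fin le_eqVlt; apply/orP; left; apply/eqP; ring.
move=> gamma P Mc c P_law gamma_w rho_lt Mc_ge0 c_ge0 cost_bound alpha bound.
have a0 : (0 < alpha)%R by exact: lt_trans rho_lt.
have [W gW] : exists W : R, \int[gamma]_y (w y)%:E = W%:E.
  exists (fine (\int[gamma]_y (w y)%:E)); rewrite fineK// ge0_fin_numE//.
  by apply: integral_ge0 => y _; rewrite lee_fin.
have cost_ge x a : adm M x a -> (- (Mc * w x + c) <= cost M x a)%R.
  move=> xa; rewrite -lee_fin EFinN leeNl.
  apply: le_trans (cost_bound x); rewrite -abseN; apply: le_trans (lee_abs _).
  by rewrite leeN2; apply: ereal_inf_lbound; exists a.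
have -> : bound = - (Mc * (alpha * W + b) / (alpha * (alpha - rho)) + c / alpha)%:E.
  by rewrite /bound gW -EFinN; congr EFin; rewrite opprD.
split; last by rewrite -EFinN ltNyr.
apply: le_trans _ (performance_ge_weight w_measurable w_ge0 pi P Mc_ge0 c_ge0 cost_ge).
rewrite leeN2.
exact: (integral_expected_cost_le mS1 mE sE Sl_measurable Sl_cover rate_bounded
  w_measurable w_ge0 rho_gt0 b_ge0 drift P_law (nonexpl _ _ P_law)).
Qed.
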